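(* Let $X(K,U)$ be an Oeljeklaus-Toma manifold and let $E$ be the flat complex line bundle over $X(K,U)$ corresponding to $\rho\in\mathrm{Hom}(U,\mathbb{C}^{*})$, regarded as a holomorphic line bundle. Then $E$ admits a non-zero holomorphic section if and only if $\rho$ is trivial.
   Context: OT-manifolds. Let $s,t$ be positive integers and $K$ an extension field of $\mathbb{Q}$ of degree $s+2t$ with embeddings $\sigma_1,\dots,\sigma_{s+2t}$ into $\mathbb{C}$, where $\sigma_1,\dots,\sigma_s$ are real and $\sigma_{s+1},\dots,\sigma_{s+2t}$ are non-real with $\sigma_{s+i}=\overline{\sigma_{s+t+i}}$ for $1\le i\le t$. Let $\mathcal{O}_K$ be the ring of integers, $\mathcal{O}_K^{*}$ its unit group and $\mathcal{O}_K^{*,+}=\{a\in\mathcal{O}_K^{*}:\sigma_i(a)>0 \text{ for } 1\le i\le s\}$. Let $U\subset\mathcal{O}_K^{*,+}$ be a free abelian subgroup of rank $s$ such that $\{(\log\sigma_1(u),\dots,\log\sigma_s(u)):u\in U\}$ is a lattice in $\mathbb{R}^{s}$. With $H=\{z\in\mathbb{C}:\mathrm{Im}\,z>0\}$, the group $U\ltimes\mathcal{O}_K$ acts on $H^{s}\times\mathbb{C}^{t}$ by $(a,b)\cdot(w_1,\dots,w_s,z_1,\dots,z_t)=(\sigma_1(a)w_1+\sigma_1(b),\dots,\sigma_s(a)w_s+\sigma_s(b),\sigma_{s+1}(a)z_1+\sigma_{s+1}(b),\dots,\sigma_{s+t}(a)z_t+\sigma_{s+t}(b))$. The quotient $X(K,U)=(U\ltimes\mathcal{O}_K)\backslash(H^{s}\times\mathbb{C}^{t})$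 is a compact complex manifold of dimension $s+t$, called an Oeljeklaus-Toma (OT) manifold; its fundamental group is $U\ltimes\mathcal{O}_K$. Flat line bundles. A homomorphism $\rho\in\mathrm{Hom}(U,\mathbb{C}^{*})$ is regarded as a character of $U\ltimes\mathcal{O}_K$ via the projection to $U$, and the corresponding flat line bundle is $E=(U\ltimes\mathcal{O}_K)\backslash\big((H^{s}\times\mathbb{C}^{t})\times\mathbb{C}\big)$ for the action $\gamma\cdot(x,c)=(\gamma x,\rho(\gamma)c)$. *)

(* Defs.v *)
(* MathComp / MathComp-Analysis, with the complex numbers R[i] over a realType
   R coming from mathcomp-real-closed. *)
From HB Require Import structures.
From mathcomp Require Import all_boot all_order all_algebra all_field.
From mathcomp Require Import complex.
From mathcomp Require Import all_classical all_reals all_analysis.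

Set Implicit Arguments.
Unset Strict Implicit.
Unset Printing Implicit Defensive.

Import Order.TTheory GRing.Theory Num.Theory numFieldNormedType.Exports.

Local Open Scope classical_set_scope.
Local Open Scope complex_scope.
Local Open Scope ring_scope.

Section NumberField.
Variables (K : fieldExtType rat).

Definition ring_of_integers : set K := [set a | integralOver (intr : int -> K) a].

Definition integer_units : set K :=
  [set a | [/\ a != 0, ring_of_integers a & ring_of_integers a^-1]].

Definition mul_subgroup (U : set K) : Prop :=
  [/\ U 1, (forall u v, U u -> U v -> U (u * v)) & (forall u, U u -> U u^-1)].

Definition free_abelian_of_rank (s : nat) (U : set K) : Prop :=
  exists2 e : 'I_s -> K, (forall i, U (e i)) &
    forall u, U u -> exists! n : 'rV[int]_s, u = \prod_(i < s) e i ^ n 0 i.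

End NumberField.

(* The Z-span of an R-basis of R^s, the basis being the rows of B. *)
Definition is_lattice (R : realType) (s : nat) (L : set 'rV[R]_s) : Prop :=
  exists2 B : 'M[R]_s, B \in unitmx &
    L = [set map_mx intr n *m B | n in [set: 'rV[int]_s]].

Section OT.
Variables (R : realType) (s t : nat) (K : fieldExtType rat).
(* The index type splits as s real embeddings, then t non-real ones, then the
   conjugates of these t embeddings in the same order. *)
Variable sigma : 'I_(s + t + t) -> {rmorphism K -> R[i]}.

Definition coord_emb (k : 'I_(s + t)) : {rmorphism K -> R[i]} :=
  sigma (lshift t k).

Definition real_emb (i : 'I_s) : {rmorphism K -> R[i]} :=
  coord_emb (lshift t i).

Record ordered_embeddings : Prop := OrderedEmbeddings {
  emb_distinct : forall k l, sigma k =1 sigma l -> k = l;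
  emb_complete : forall tau : {rmorphism K -> R[i]}, exists k, tau =1 sigma k;
  emb_real : forall (i : 'I_s) a, complex.Im (real_emb i a) = 0;
  emb_nonreal : forall j : 'I_t,
    exists a, complex.Im (coord_emb (rshift s j) a) != 0;
  emb_conj : forall (j : 'I_t) a,
    coord_emb (rshift s j) a = conjc (sigma (rshift (s + t) j) a) }.

(* In the order of R[i], 0 < z means that z is real and positive. *)
Definition positive_units : set K :=
  [set a | integer_units a /\ forall i, 0 < real_emb i a].

Definition log_emb (u : K) : 'rV[R]_s :=
  \row_(i < s) ln (complex.Re (real_emb i u)).

Record admissible (U : set K) : Prop := Admissible {
  adm_units : U `<=` positive_units;
  adm_subgroup : mul_subgroup U;
  adm_free : free_abelian_of_rank s U;
  adm_lattice : is_lattice [set log_emb u | u in U] }.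

(* H^s x C^t as a subset of C^(s+t). *)
Definition OT_domain : set 'rV[R[i]]_(s + t) :=
  [set x | forall i : 'I_s, 0 < complex.Im (x 0 (lshift t i))].

Variable U : set K.

(* The underlying set of the semidirect product of U and O_K, with group law
   (a, b) (a', b') = (a a', a b' + b). *)
Definition OT_group : set (K * K) := U `*` @ring_of_integers K.

Definition OT_act (g : K * K) (x : 'rV[R[i]]_(s + t)) : 'rV[R[i]]_(s + t) :=
  \row_k (coord_emb k g.1 * x 0 k + coord_emb k g.2).

Definition OT_orbit (x : 'rV[R[i]]_(s + t)) : set 'rV[R[i]]_(s + t) :=
  [set OT_act g x | g in OT_group].

(* X(K, U): the points of the quotient are the orbits. *)
Definition OT_manifold : set (set 'rV[R[i]]_(s + t)) :=
  [set OT_orbit x | x in OT_domain].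

(* Homomorphisms U -> C^*; the values of rho outside U are irrelevant. *)
Definition character (rho : K -> R[i]) : Prop :=
  (forall u, U u -> rho u != 0) /\
  (forall u v, U u -> U v -> rho (u * v) = rho u * rho v).

Variable rho : K -> R[i].

Definition line_act (g : K * K) (p : 'rV[R[i]]_(s + t) * R[i]) :
    'rV[R[i]]_(s + t) * R[i] :=
  (OT_act g p.1, rho g.1 * p.2).

Definition line_orbit (p : 'rV[R[i]]_(s + t) * R[i]) :
    set ('rV[R[i]]_(s + t) * R[i]) :=
  [set line_act g p | g in OT_group].

(* The total space E of the flat line bundle; its points are again orbits. *)
Definition flat_bundle : set (set ('rV[R[i]]_(s + t) * R[i])) :=
  [set line_orbit p | p in OT_domain `*` setT].

(* The bundle projection E -> X, sending the orbit of (x, c) to that of x. *)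
Definition bundle_proj (e : set ('rV[R[i]]_(s + t) * R[i])) :
    set 'rV[R[i]]_(s + t) :=
  fst @` e.

(* The holomorphic structures of X and E are those of the quotients: on a
   small open subset V of H^s x C^t the map x |-> [x] is a chart of X, and
   (x, c) |-> [x, c] trivializes E over its image.  A section is holomorphic
   when in these trivializations it reads x |-> (x, f x) with f holomorphic,
   that is, complex (Frechet) differentiable on an open set.  The casts to
   numFieldType let the norm topology on C^(s+t) be inferred. *)
Record holomorphic_section
    (sec : set 'rV[R[i]]_(s + t) -> set ('rV[R[i]]_(s + t) * R[i])) : Prop :=
  HolomorphicSection {
    section_in_bundle : forall p, OT_manifold p -> flat_bundle (sec p);
    section_proj : forall p, OT_manifold p -> bundle_proj (sec p) = p;
    section_holomorphic : forall x : 'rV[R[i]]_(s + t), OT_domain x ->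
      exists2 f : 'rV[R[i]]_(s + t) -> R[i]^o,
        (\forall y \near (x : 'rV[R[i] : numFieldType]_(s + t)),
          differentiable f y) &
        (\forall y \near (x : 'rV[R[i] : numFieldType]_(s + t)),
          sec (OT_orbit y) = line_orbit (y, f y)) }.

(* sec does not coincide with the zero section [x] |-> [x, 0]. *)
Definition nonzero_section
    (sec : set 'rV[R[i]]_(s + t) -> set ('rV[R[i]]_(s + t) * R[i])) : Prop :=
  exists2 x, OT_domain x & sec (OT_orbit x) <> line_orbit (x, 0).

End OT.

(* Main.v *)
Require Import Defs.
From HB Require Import structures.
From mathcomp Require Import all_boot all_order all_algebra all_field.
From mathcomp Require Import complex ring lra.
From mathcomp Require Import all_classical all_reals all_analysis.

Set Implicit Arguments.
Unset Strict Implicit.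
Unset Printing Implicit Defensive.

Import Order.TTheory GRing.Theory Num.Theory numFieldNormedType.Exports.

Local Open Scope classical_set_scope.
Local Open Scope complex_scope.
Local Open Scope ring_scope.

(** A section of the flat bundle is a holomorphic function [F] on [H^s x C^t]
    with [F (g x) = rho g * F x]; in particular [F] is invariant under the
    translations by [O_K].  Since [O_K] is cocompact in [R^s x C^t], [F] is
    bounded on each set [x + (R^s x C^t)], so by Liouville's theorem it does not
    depend on the coordinates of [C^t].  Hence [F] is invariant under the
    translations by the real embeddings of [O_K], which are dense in [R^s]: for
    [u] in [U] with all [sigma_i u] small, the lattice errors in approximating
    [r / u] by [O_K] shrink after multiplication by [u].  So [F] is invariant
    under [R^s], its derivatives vanish, [F] is constant, and a non-zero constant
    forces [rho = 1].

    Liouville's theorem only needs Goursat's theorem for rectangles, applied to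
    [w |-> g (z + e^w) e^(-w)], with integrals of continuous functions defined
    as increments of antiderivatives. *)

(** * Antiderivatives of continuous functions *)

Section RealVariable.
Variable R : realType.

(** Multiplying by [|h|] instead of dividing by [h] lets [h = 0] in without a case distinction. The
    proof passes through Carathéodory's slope function. *)
Lemma is_derive_epsP (F : R -> R) (x c : R) :
  is_derive x 1 F c <->
  forall e : R, 0 < e -> exists2 d : R, 0 < d &
    forall h, `|h| < d -> `|F (x + h) - F x - c * h| <= e * `|h|.
Proof.
split=> [dF e e0|H].
  have /is_derive1_caratheodory [g [gE gC gx]] := dF.
  have /cvgrPdist_le /(_ e e0) := gC.
  rewrite near_simpl => -/nbhs_ballP [d d0 Hd]; exists d => // h hd.
  have -> : F (x + h) - F x - c * h = (g (x + h) - c) * h.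
    by rewrite gE addrAC subrr add0r -mulrBl.
  rewrite normrM ler_wpM2r // -gx distrC; apply: Hd.
  by rewrite /ball /= opprD addNKr normrN.
apply/is_derive1_caratheodory.
(* The slope function: difference quotients away from [x], the prescribed derivative [c] at [x]. *)
exists (fun z => if z == x then c else (F z - F x) / (z - x)); split.
- move=> z; case: eqP => [->|/eqP]; first by rewrite !subrr mulr0.
  by rewrite -subr_eq0 => /divfK.
- apply/cvgrPdist_le => e e0; have [d d0 Hd] := H e e0.
  rewrite eqxx; near=> z; case: eqP => [_|/eqP zx].
    by rewrite subrr normr0 ltW.
  have zx0 : z - x != 0 by rewrite subr_eq0.
  have := Hd (z - x); rewrite [x + _]addrC subrK => Hz.
  have -> : c - (F z - F x) / (z - x) = - ((F z - F x - c * (z - x)) / (z - x)).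
    by field.
  rewrite normrN normrM normfV ler_pdivrMr ?normr_gt0 //; apply: Hz.
  rewrite distrC; near: z; apply/nbhs_ballP; exists d => // z.
- by rewrite eqxx.
Unshelve. all: by end_near. Qed.

Lemma MVT_bound (F f : R -> R) (a b M : R) : a <= b ->
  (forall x, a <= x <= b -> is_derive x 1 F (f x)) ->
  (forall x, a <= x <= b -> `|f x| <= M) ->
  `|F b - F a| <= M * (b - a).
Proof.
move=> ab dF fM; have [| |c] := @MVT_segment R F f a b ab.
- by move=> x; rewrite in_itv /= => /andP[/ltW ? /ltW ?]; apply: dF; apply/andP.
- apply: continuous_in_subspaceT => x; rewrite inE /= in_itv /= => xab.
  have /@ex_derive := dF x xab.
  by move=> /derivable1_diffP/differentiable_continuous.
- rewrite in_itv /= => cab ->; rewrite normrM (ger0_norm (x := b - a)) ?subr_ge0 //.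
  by rewrite ler_wpM2r ?subr_ge0 ?fM.
Qed.

(** The fundamental theorem of calculus gives an antiderivative on each [(-n, n)]. Normalized to
    vanish at 0, these agree on overlaps and glue to one on the whole line. *)
Lemma continuous_antiderivative (f : R -> R) : continuous f ->
  exists F : R -> R, forall x : R, is_derive x 1 F (f x).
Proof.
move=> cf.
have H (n : nat) : exists F : R -> R, forall x : R, - n%:R < x < n%:R -> is_derive x 1 F (f x).
  exists (fun x => \int[@lebesgue_measure R]_(t in `[- n%:R, x]) f t)%R => x /andP[nx xn].
  have := @continuous_FTC1_closed R f (- n%:R) x n%:R xn _ nx (cf x).
  case.
    apply: continuous_compact_integrable; first exact: segment_compact.
    by apply: continuous_subspaceT.
  by move=> ? <-; rewrite derive1E; apply: derivableP.
have [G HG] := choice H.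
(* An integer beyond [|x|], so that [G (N x)] has derivative [f x] at [x]. *)
pose N (x : R) := (Num.truncn `|x|).+1.
have NE x : - (N x)%:R < x < (N x)%:R by rewrite -ltr_norml truncnS_gt.
exists (fun x => G (N x) x - G (N x) 0) => x.
(* The difference of two antiderivatives has derivative 0, so [MVT_bound] with bound 0 applies
   between 0 and [y], on either side of 0. *)
have agree n m y : `|y| < n%:R -> `|y| < m%:R -> G n y - G n 0 = G m y - G m 0.
  rewrite !ltr_norml => yn ym; apply/eqP; rewrite -subr_eq0 -normr_le0.
  have key a b : a <= b -> (forall z, a <= z <= b -> `|z| < n%:R /\ `|z| < m%:R) ->
      `|(G n b - G m b) - (G n a - G m a)| <= 0 * (b - a).
    move=> ab Hz; apply: (@MVT_bound (fun z => G n z - G m z) (fun z => 0)) => //.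
      move=> z zab; have [] := Hz z zab; rewrite !ltr_norml => zn zm.
      have := HG n z zn; have := HG m z zm => ? ?.
      by apply: is_derive_eq; rewrite subrr.
    by rewrite normr0.
  case: (lerP 0 y) => y0.
    rewrite (_ : _ - _ = (G n y - G m y) - (G n 0 - G m 0)); last by ring.
    apply: (le_trans (key 0 y y0 _)); last by rewrite mul0r.
    by move=> z /andP[? ?]; rewrite !ltr_norml; split; lra.
  rewrite distrC (_ : _ - _ = (G n 0 - G m 0) - (G n y - G m y)); last by ring.
  apply: (le_trans (key y 0 (ltW y0) _)); last by rewrite mul0r.
  by move=> z /andP[? ?]; rewrite !ltr_norml; split; lra.
have := HG _ _ (NE x) => /is_derive_epsP HGx.
apply/is_derive_epsP => e e0; have [d d0 Hd] := HGx e e0.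
(* The second bound keeps [x + h] where [G (N x)] can replace [G (N (x + h))]. *)
exists (Num.min d ((N x)%:R - `|x|)).
  by rewrite lt_min d0 subr_gt0 truncnS_gt.
move=> h; rewrite lt_min => /andP[hd hN].
rewrite (@agree _ (N x) (x + h)).
- rewrite (_ : _ - _ - (_ - _) = G (N x) (x + h) - G (N x) x); last by ring.
  exact: Hd.
- by rewrite ltr_norml.
- by rewrite (le_lt_trans (ler_normD _ _)) // -ltrBrDl.
Qed.

End RealVariable.

(** * Complex derivatives and Goursat's theorem *)

Section ComplexCalculus.
Variable R : realType.
Local Notation C := R[i].
Local Notation Re := (@complex.Re R).
Local Notation Im := (@complex.Im R).

(* Unlike the modulus of [R[i]], it has values in [R]; being submultiplicative
   is all that the estimates below require. *)
Definition l1norm (z : C) : R := `|Re z| + `|Im z|.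

Lemma l1norm_ge0 z : 0 <= l1norm z.
Proof. by rewrite addr_ge0. Qed.

Lemma l1norm0 : l1norm 0 = 0.
Proof. by rewrite /l1norm /= normr0 addr0. Qed.

Lemma l1normN z : l1norm (- z) = l1norm z.
Proof. by case: z => a b; rewrite /l1norm /= !normrN. Qed.

Lemma l1normB z w : l1norm (z - w) = l1norm (w - z).
Proof. by rewrite -l1normN opprB. Qed.

Lemma l1normD z w : l1norm (z + w) <= l1norm z + l1norm w.
Proof.
case: z w => a b [c d]; rewrite /l1norm /=.
by rewrite addrACA lerD ?ler_normD.
Qed.

Lemma l1normM z w : l1norm (z * w) <= l1norm z * l1norm w.
Proof.
case: z w => a b [c d]; rewrite /l1norm /=.
apply: (@le_trans _ _ ((`|a| * `|c| + `|b| * `|d|) + (`|a| * `|d| + `|b| * `|c|))).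
  by rewrite lerD // -!normrM ?(le_trans (ler_normB _ _)) ?(le_trans (ler_normD _ _)).
by rewrite le_eqVlt; apply/orP; left; apply/eqP; ring.
Qed.

Lemma l1norm_realM (a : R) z : l1norm (a%:C * z) = `|a| * l1norm z.
Proof.
by case: z => c d; rewrite /l1norm /= !mul0r subr0 addr0 !normrM mulrDr.
Qed.

Lemma l1norm_eq0 z : (l1norm z == 0) = (z == 0).
Proof.
by case: z => a b; rewrite /l1norm paddr_eq0 // !normr_eq0 eq_complex.
Qed.

(** The sign of [K] is arbitrary, hence the rescaling of [e] by [|K| + 1]. *)
Lemma l1norm_le_eps0 z (K : R) :
  (forall e : R, 0 < e -> l1norm z <= K * e) -> z = 0.
Proof.
move=> H; apply/eqP; rewrite -l1norm_eq0 eq_le l1norm_ge0 andbT.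
apply/ler_addgt0Pr => e e0; rewrite add0r.
have K0 : 0 < `|K| + 1 by rewrite ltr_wpDl.
apply: (le_trans (H (e / (`|K| + 1)) (divr_gt0 e0 K0))).
rewrite mulrA ler_pdivrMr // [K * e]mulrC ler_pM2l //.
by rewrite (le_trans (ler_norm K)) // lerDl.
Qed.

(** The usual complex derivative, since [l1norm] is equivalent to the modulus; as in
    [is_derive_epsP], no division by [h] occurs. *)
Definition cderiv_at (f : C -> C) (p c : C) := forall e : R, 0 < e ->
  exists2 d : R, 0 < d & forall h, l1norm h < d ->
    l1norm (f (p + h) - f p - c * h) <= e * l1norm h.

Lemma cderiv_at_lip f p c : cderiv_at f p c ->
  exists2 d : R, 0 < d & forall h, l1norm h < d ->
    l1norm (f (p + h) - f p) <= (l1norm c + 1) * l1norm h.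
Proof.
move=> /(_ 1 ltr01) [d d0 H]; exists d => // h /H; rewrite mul1r => Hh.
rewrite -[f _ - _](subrK (c * h)) (le_trans (l1normD _ _)) //.
by rewrite mulrDl mul1r addrC lerD // l1normM.
Qed.

Lemma cderiv_at_comp f g p c d : cderiv_at f (g p) c -> cderiv_at g p d ->
  cderiv_at (f \o g) p (c * d).
Proof.
move=> df dg e e0.
pose A := l1norm d + 1; pose B := l1norm c + 1.
have A0 : 0 < A by rewrite ltr_wpDl ?l1norm_ge0.
have B0 : 0 < B by rewrite ltr_wpDl ?l1norm_ge0.
have [r1 r10 H1] := df (e / 2 / A) ltac:(by rewrite !divr_gt0).
have [r2 r20 H2] := dg (e / 2 / B) ltac:(by rewrite !divr_gt0).
have [r3 r30 H3] := cderiv_at_lip dg.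
exists (Num.min r2 (Num.min r3 (r1 / A))); first by rewrite !lt_min r20 r30 divr_gt0.
move=> h; rewrite !lt_min => /and3P[/H2 h2 /H3 h3 hr1] /=.
have /H1 h1 : l1norm (g (p + h) - g p) < r1.
  by apply: le_lt_trans h3 _; rewrite mulrC -ltr_pdivlMr.
rewrite [g p + _]addrC subrK in h1.
rewrite (_ : _ - _ - _ = (f (g (p + h)) - f (g p) - c * (g (p + h) - g p))
   + c * (g (p + h) - g p - d * h)); last by ring.
apply: le_trans (l1normD _ _) _.
rewrite [e]splitr [leRHS]mulrDl lerD //.
  apply: le_trans h1 _; rewrite -mulrA ler_pM2l ?divr_gt0 //.
  by rewrite ler_pdivrMl.
apply: le_trans (l1normM _ _) _.
apply: (@le_trans _ _ (B * (e / 2 / B * l1norm h))).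
  by rewrite ler_pM ?l1norm_ge0 // lerDl.
by rewrite mulrA [B * _]mulrC divfK ?gt_eqF.
Qed.

Lemma cderiv_atM f g p c d : cderiv_at f p c -> cderiv_at g p d ->
  cderiv_at (fun z => f z * g z) p (c * g p + f p * d).
Proof.
move=> df dg e e0.
pose A := l1norm c + 1; pose B := l1norm d + 1.
pose K := l1norm (g p) + l1norm (f p) + A * B.
have A0 : 0 < A by rewrite ltr_wpDl ?l1norm_ge0.
have B0 : 0 < B by rewrite ltr_wpDl ?l1norm_ge0.
have K0 : 0 < K by rewrite ltr_wpDl ?addr_ge0 ?l1norm_ge0 ?mulr_gt0.
have eK : 0 < e / K by rewrite divr_gt0.
have [r1 r10 H1] := df _ eK.
have [r2 r20 H2] := dg _ eK.
have [r3 r30 H3] := cderiv_at_lip df.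
have [r4 r40 H4] := cderiv_at_lip dg.
exists (Num.min (Num.min r1 r2) (Num.min (Num.min r3 r4) (e / K))).
  by rewrite !lt_min r10 r20 r30 r40.
move=> h; rewrite !lt_min => /and3P[/andP[/H1 h1 /H2 h2] /andP[/H3 h3 /H4 h4] heK].
rewrite (_ : _ - _ - _ = (f (p + h) - f p - c * h) * g p +
  f p * (g (p + h) - g p - d * h) + (f (p + h) - f p) * (g (p + h) - g p)); last by ring.
apply: (@le_trans _ _ (e / K * l1norm h * l1norm (g p) + l1norm (f p) * (e / K * l1norm h)
   + A * l1norm h * (B * (e / K)))).
  apply: le_trans (l1normD _ _) _; apply: lerD.
    apply: le_trans (l1normD _ _) _; apply: lerD.
      by apply: le_trans (l1normM _ _) _; rewrite ler_wpM2r ?l1norm_ge0.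
    by apply: le_trans (l1normM _ _) _; rewrite ler_wpM2l ?l1norm_ge0.
  apply: le_trans (l1normM _ _) _.
  rewrite ler_pM ?l1norm_ge0 // (le_trans h4) // ler_wpM2l ?(ltW B0) ?(ltW heK) //.
rewrite (_ : _ + _ = e / K * l1norm h * K); last by rewrite /K; ring.
by rewrite mulrAC divfK ?gt_eqF.
Qed.

Lemma cderiv_at_affine a b p : cderiv_at (fun z => a + b * z) p b.
Proof.
move=> e e0; exists 1 => // h _.
rewrite (_ : _ - _ = 0); last by ring.
by rewrite l1norm0 mulr_ge0 ?l1norm_ge0 ?ltW.
Qed.

Definition path_deriv (g : R -> C) (t : R) (c : C) :=
  is_derive t 1 (Re \o g) (Re c) /\ is_derive t 1 (Im \o g) (Im c).

Lemma cderiv_at_line f p v t c : cderiv_at f (p + t%:C * v) c ->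
  path_deriv (fun r => f (p + r%:C * v)) t (c * v).
Proof.
move=> df.
(* Real and imaginary parts are treated together: only real linearity and the bound by [l1norm]
   matter. *)
have key (P : C -> R) (PB : forall x y, P (x - y) = P x - P y)
    (PZ : forall a x, P (a%:C * x) = a * P x) (Ple : forall x, `|P x| <= l1norm x) :
    is_derive t 1 (P \o (fun r => f (p + r%:C * v))) (P (c * v)).
  apply/is_derive_epsP => e e0.
  have V0 : 0 < l1norm v + 1 by rewrite ltr_wpDl ?l1norm_ge0.
  have [r r0 H] := df (e / (l1norm v + 1)) (divr_gt0 e0 V0).
  exists (r / (l1norm v + 1)); first by rewrite divr_gt0.
  move=> h; rewrite ltr_pdivlMr // => hr.
  have hv : l1norm (h%:C * v) <= `|h| * (l1norm v + 1).
    by rewrite l1norm_realM ler_wpM2l // lerDl.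
  have {}H := H _ (le_lt_trans hv hr).
  rewrite /= [P (c * v) * h]mulrC -PZ -!PB.
  rewrite (_ : _ - _ - _ = f (p + t%:C * v + h%:C * v) - f (p + t%:C * v) - c * (h%:C * v)).
    apply: le_trans (Ple _) _; apply: le_trans H _.
    by rewrite mulrAC ler_pdivrMr // -mulrA ler_wpM2l // ltW.
  by rewrite rmorphD /=; rewrite mulrDl addrA; ring.
split; apply: key.
- by move=> x y; rewrite raddfB.
- by move=> a [x y] /=; rewrite mul0r subr0.
- by move=> x; rewrite /l1norm lerDl.
- by move=> x y; rewrite raddfB.
- by move=> a [x y] /=; rewrite mul0r addr0.
- by move=> x; rewrite /l1norm lerDr.
Qed.

Lemma path_derivB g1 g2 t c1 c2 : path_deriv g1 t c1 -> path_deriv g2 t c2 ->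
  path_deriv (fun s => g1 s - g2 s) t (c1 - c2).
Proof.
move=> [r1 i1] [r2 i2]; split; rewrite raddfB /=.
  rewrite (_ : _ \o _ = (Re \o g1) - (Re \o g2)); first exact: is_deriveB.
  by apply/funext => s /=; rewrite raddfB.
rewrite (_ : _ \o _ = (Im \o g1) - (Im \o g2)); first exact: is_deriveB.
by apply/funext => s /=; rewrite raddfB.
Qed.

(** The mean value inequality is applied to the real and imaginary parts separately, which costs the
    factor 2. *)
Lemma path_MVT (g g' : R -> C) (a b M : R) : a <= b ->
  (forall t, a <= t <= b -> path_deriv g t (g' t)) ->
  (forall t, a <= t <= b -> l1norm (g' t) <= M) ->
  l1norm (g b - g a) <= 2 * M * (b - a).
Proof.
move=> ab dg Mg; rewrite /l1norm !raddfB /= mulrDl mul1r mulrDl lerD //.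
  apply: (@MVT_bound R (Re \o g) (Re \o g')) => // t tab; first by case: (dg t tab).
  by apply: le_trans (Mg t tab); rewrite /l1norm lerDl.
apply: (@MVT_bound R (Im \o g) (Im \o g')) => // t tab; first by case: (dg t tab).
by apply: le_trans (Mg t tab); rewrite /l1norm lerDr.
Qed.

Lemma cderiv0_segment f p v :
  (forall t : R, 0 <= t <= 1 -> cderiv_at f (p + t%:C * v) 0) -> f (p + v) = f p.
Proof.
move=> df; have := @path_MVT (fun r => f (p + r%:C * v)) (fun=> 0) 0 1 0 ler01.
rewrite mul1r mul0r addr0 mulr0 mul0r => H; apply/eqP.
rewrite -subr_eq0 -l1norm_eq0 eq_le l1norm_ge0 andbT; apply: H => t t01.
  by rewrite -[0](mul0r v); apply: cderiv_at_line; apply: df.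
by rewrite l1norm0.
Qed.

End ComplexCalculus.

(** * Line integrals and Goursat's theorem for rectangles *)

Section Goursat.
Variable R : realType.
Local Notation C := R[i].
Local Notation Re := (@complex.Re R).
Local Notation Im := (@complex.Im R).

(** An arbitrary choice, with the zero function as default; when an antiderivative exists, its
    increments do not depend on the choice. *)
Definition antiderivative (h : R -> R) : R -> R :=
  xget (fun=> 0) [set F | forall x : R, is_derive x 1 F (h x)].

Lemma antiderivativeP h : continuous h -> forall x : R, is_derive x 1 (antiderivative h) (h x).
Proof.
by move=> /continuous_antiderivative[F HF]; rewrite /antiderivative; case: xgetP => [_ ->|/(_ F)].
Qed.

(** The integral of [f(z) dz] over the segment from [p + a v] to [p + b v]. *)
Definition line_integral (f : C -> C) (p v : C) (a b : R) : C :=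
  let g t := f (p + t%:C * v) * v in
  let G t := antiderivative (Re \o g) t +i* antiderivative (Im \o g) t in
  G b - G a.

Definition entire (f : C -> C) := forall p, exists c, cderiv_at f p c.

Lemma entireM f g : entire f -> entire g -> entire (fun z => f z * g z).
Proof.
by move=> df dg p; have [[c Hc] [d Hd]] := (df p, dg p); eexists; apply: cderiv_atM Hc Hd.
Qed.

Lemma entire_comp f g : entire f -> entire g -> entire (f \o g).
Proof.
move=> df dg p; have [d Hd] := dg p; have [c Hc] := df (g p).
by eexists; apply: cderiv_at_comp Hc Hd.
Qed.

Lemma entire_affine a b : entire (fun z : C => a + b * z).
Proof. by move=> p; eexists; apply: cderiv_at_affine. Qed.

(** The integral, as a function of its upper end, minus [A] along the segment has derivative
    [(f - A') v], to which [path_MVT] applies. It serves with [A'] an explicit approximation of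
    [f]. *)
Lemma line_integral_approx f A A' p v a b M : entire f ->
  (forall z, cderiv_at A z (A' z)) -> a <= b ->
  (forall t, a <= t <= b -> l1norm ((f (p + t%:C * v) - A' (p + t%:C * v)) * v) <= M) ->
  l1norm (line_integral f p v a b - (A (p + b%:C * v) - A (p + a%:C * v)))
    <= 2 * M * (b - a).
Proof.
move=> df dA ab HM.
pose g := fun t => f (p + t%:C * v) * v.
have dg t : exists c, path_deriv g t c.
  (* The constant factor [v] is written as the affine function [v + 0 * z]. *)
  have [c Hc] := entireM df (entire_affine v 0) (p + t%:C * v).
  exists (c * v); have := cderiv_at_line Hc.
  by congr path_deriv; apply/funext => s; rewrite /g mul0r addr0.
have cont (P : C -> R) : (forall t : R, exists c, is_derive t 1 (P \o g) c) -> continuous (P \o g).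
  move=> H t; have [c dc] := H t.
  by have /@ex_derive/derivable1_diffP/differentiable_continuous := dc.
have Rg : continuous (Re \o g) by apply: cont => t; have [c []] := dg t; exists (Re c).
have Ig : continuous (Im \o g) by apply: cont => t; have [c []] := dg t; exists (Im c).
pose G t := antiderivative (Re \o g) t +i* antiderivative (Im \o g) t.
rewrite -[line_integral _ _ _ _ _]/(G b - G a).
have dG t : path_deriv G t (g t).
  by split; [exact: antiderivativeP Rg t|exact: antiderivativeP Ig t].
rewrite (_ : _ - _ = (G b - A (p + b%:C * v)) - (G a - A (p + a%:C * v))); last by ring.
apply: (@path_MVT _ (fun t => G t - A (p + t%:C * v)) (fun t => g t - A' (p + t%:C * v) * v)) => //.
  by move=> t _; apply: path_derivB => //; apply: cderiv_at_line; apply: dA.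
by move=> t tab; rewrite /g -mulrBl; apply: HM.
Qed.

(** The counterclockwise boundary integral over [[x, x + a] x [y, y + b]]. The base points are
    chosen on the axes, so that all pieces of one line use the same antiderivative and additivity is
    mere telescoping. *)
Definition rect_integral f (x y a b : R) : C :=
  line_integral f (0 +i* y) 1 x (x + a) + line_integral f (x + a)%:C 'i y (y + b)
  - line_integral f (0 +i* (y + b)) 1 x (x + a) - line_integral f x%:C 'i y (y + b).

Lemma rect_integral_split f x y a b :
  rect_integral f x y (a + a) (b + b) =
  rect_integral f x y a b + rect_integral f (x + a) y a b +
  rect_integral f x (y + b) a b + rect_integral f (x + a) (y + b) a b.
Proof. by rewrite /rect_integral /line_integral !addrA; ring. Qed.

(* Bisection: a failure at scale 1 would propagate to arbitrarily small similar
   rectangles shrinking to a point. *)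
Lemma rectangle_induction (a b : R) (P : R -> R -> R -> Prop) : 0 <= a -> 0 <= b ->
  (forall x y h, 0 < h ->
     P x y h -> P (x + a * h) y h -> P x (y + b * h) h -> P (x + a * h) (y + b * h) h ->
     P x y (h + h)) ->
  (forall p q, exists2 d : R, 0 < d & forall x y h, 0 < h < d ->
     x <= p <= x + a * h -> y <= q <= y + b * h -> P x y h) ->
  forall x y, P x y 1.
Proof.
move=> a0 b0 Psplit Ploc x y; apply: contrapT => nP.
(* A cell [(corner, scale)] where [P] fails has a quarter where [P] fails. Nothing is asked when [P]
   holds, so that choice yields a total function [next]. *)
have step (z : R * R * R) : exists z' : R * R * R, 0 < z.2 -> ~ P z.1.1 z.1.2 z.2 ->
    [/\ ~ P z'.1.1 z'.1.2 z'.2, z'.2 = z.2 / 2,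
      z.1.1 <= z'.1.1 <= z.1.1 + a * z'.2 & z.1.2 <= z'.1.2 <= z.1.2 + b * z'.2].
  case: z => [[u v] h] /=.
  have [[h0 nPh]|] := pselect (0 < h /\ ~ P u v h); last first.
    by move=> nn; exists (u, v, h) => h0 nPh; exfalso; apply: nn.
  have h20 : 0 < h / 2 by rewrite divr_gt0.
  have ah : 0 <= a * (h / 2) by rewrite mulr_ge0 // ltW.
  have bh : 0 <= b * (h / 2) by rewrite mulr_ge0 // ltW.
  have [P1|n1] := pselect (P u v (h / 2)); last first.
    by exists (u, v, h / 2) => _ _; split; rewrite //= lexx lerDl.
  have [P2|n2] := pselect (P (u + a * (h / 2)) v (h / 2)); last first.
    by exists (u + a * (h / 2), v, h / 2) => _ _; split; rewrite //= ?lexx lerDl ?ah.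
  have [P3|n3] := pselect (P u (v + b * (h / 2)) (h / 2)); last first.
    by exists (u, v + b * (h / 2), h / 2) => _ _; split; rewrite //= ?lexx lerDl ?bh.
  exists (u + a * (h / 2), v + b * (h / 2), h / 2) => _ _.
  split; rewrite //= ?lexx ?lerDl ?ah ?bh // => P4.
  by apply: nPh; rewrite (splitr h); apply: Psplit.
have [next Hnext] := choice step.
pose u n := iter n next (x, y, 1).
have u2 n : 0 < (u n).2 /\ ~ P (u n).1.1 (u n).1.2 (u n).2.
  elim: n => [|n [IH1 IH2]]; first by split.
  have [H1 H2 _ _] := Hnext _ IH1 IH2.
  by split; rewrite /u iterS -/(u n) // H2 divr_gt0.
have uS n : [/\ (u n.+1).2 = (u n).2 / 2,
    (u n).1.1 <= (u n.+1).1.1 <= (u n).1.1 + a * (u n.+1).2 &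
    (u n).1.2 <= (u n.+1).1.2 <= (u n).1.2 + b * (u n.+1).2].
  by have [h0 nPn] := u2 n; have [] := Hnext _ h0 nPn.
have uE n : (u n).2 = 2^-1 ^+ n.
  by elim: n => // n IH; have [-> _ _] := uS n; rewrite IH exprSr.
(* Nested intervals, one coordinate at a time: left ends increase, right ends decrease, and the
   supremum of the left ends lies in every interval. *)
have common (w : nat -> R) (k : R) : 0 <= k ->
    (forall n, w n <= w n.+1 <= w n + k * (u n.+1).2) ->
    exists p, forall n, w n <= p <= w n + k * (u n).2.
  move=> k0 Hw.
  have wmono n m : w n <= w (n + m)%N.
    elim: m => [|m IH]; first by rewrite addn0.
    by rewrite addnS; have /andP[+ _] := Hw (n + m)%N; apply: le_trans.
  have wanti n m : w (n + m)%N + k * (u (n + m)%N).2 <= w n + k * (u n).2.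
    elim: m => [|m IH]; first by rewrite addn0.
    rewrite addnS; apply: le_trans IH; have /andP[_ H1] := Hw (n + m)%N.
    have [E _ _] := uS (n + m)%N.
    apply: (le_trans (lerD H1 (lexx _))).
    by rewrite -addrA -mulrDr E -splitr.
  have wle n m : w n <= w m + k * (u m).2.
    have ge0 i : 0 <= k * (u i).2 by rewrite mulr_ge0 // ltW //; have [] := u2 i.
    have [nm|/ltnW mn] := leqP n m.
      by rewrite -(subnKC nm); apply: le_trans (wmono n (m - n)%N) _; rewrite lerDl.
    by rewrite -(subnKC mn); apply: le_trans (wanti m (n - m)%N); rewrite lerDl.
  exists (sup (range w)) => n; apply/andP; split.
    apply: ub_le_sup; last by exists n.
    by exists (w 0%N + k * (u 0%N).2) => _ [m _ <-].
  by apply: ge_sup; [exists (w n), n|move=> _ [m _ <-]].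
have [p Hp] := common (fun n => (u n).1.1) a a0 (fun n => let: And3 _ H _ := uS n in H).
have [q Hq] := common (fun n => (u n).1.2) b b0 (fun n => let: And3 _ _ H := uS n in H).
have [d d0 Hd] := Ploc p q.
have [n Hn] : exists n, (u n).2 < d.
  have /cvgrPdist_lt /(_ d d0) [N _ HN] : (fun n => 2^-1 ^+ n : R) @ \oo --> 0.
    by apply: cvg_expr; rewrite ger0_norm ?invf_lt1 ?ltr1n ?invr_ge0.
  exists N; rewrite uE; have := HN N (leqnn N).
  by rewrite /= sub0r normrN ger0_norm // exprn_ge0 // invr_ge0.
have [un0 nPn] := u2 n; apply: nPn; apply: Hd => //.
by rewrite un0.
Qed.

Lemma Goursat f x y a b : entire f -> 0 <= a -> 0 <= b -> rect_integral f x y a b = 0.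
Proof.
move=> df a0 b0; apply: (@l1norm_le_eps0 _ _ 1) => e e0; rewrite mul1r.
(* The bound scales like the area: four cells of scale [h] give exactly the bound at scale
   [h + h]. *)
pose P x y h := l1norm (rect_integral f x y (a * h) (b * h)) <= e * h ^+ 2.
suff : P x y 1 by rewrite /P !mulr1 expr1n mulr1.
apply: (@rectangle_induction a b P) => //.
  move=> {}x {}y h h0 H1 H2 H3 H4; rewrite /P !mulrDr rect_integral_split.
  apply: (@le_trans _ _ (e * h ^+ 2 + e * h ^+ 2 + e * h ^+ 2 + e * h ^+ 2)); last first.
    by rewrite le_eqVlt; apply/orP; left; apply/eqP; ring.
  apply: le_trans (lerD (lerD (lerD H1 H2) H3) H4).
  by do 3 (apply: le_trans (l1normD _ _) _; rewrite ?lerD2r).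
move=> p q; pose w0 := p +i* q; have [c Hc] := df w0.
(* The four sides together contribute [4 (a + b)^2 (e / k) h^2]; the added 1 keeps [k] positive when
   [a = b = 0]. *)
pose k := 4 * (a + b) ^+ 2 + 1.
have k0 : 0 < k by rewrite ltr_wpDl // mulr_ge0 // sqr_ge0.
have ab0 : 0 < a + b + 1 by rewrite ltr_wpDl // addr_ge0.
have [d d0 Hd] := Hc (e / k) (divr_gt0 e0 k0).
exists (d / (a + b + 1)); first by rewrite divr_gt0.
move=> {}x {}y h /andP[h0]; rewrite ltr_pdivlMr // => hd /andP[p1 p2] /andP[q1 q2].
have ah : 0 <= a * h by rewrite mulr_ge0 // ltW.
have bh : 0 <= b * h by rewrite mulr_ge0 // ltW.
(* An antiderivative of the affine approximation [A'] of [f] at [w0], written as a product of affine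
   functions to fit [cderiv_atM] and [cderiv_at_affine]. *)
pose A z := (0 + 1 * z) * ((f w0 - c * w0) + c / 2 * z).
pose A' z := f w0 + c * (z - w0).
have dA z : cderiv_at A z (A' z).
  have := cderiv_atM (cderiv_at_affine 0 1 z) (cderiv_at_affine (f w0 - c * w0) (c / 2) z).
  by congr (cderiv_at _ _ _); rewrite /A'; field.
pose M := e / k * ((a + b) * h).
have close s t : x <= s <= x + a * h -> y <= t <= y + b * h ->
    l1norm (f (s +i* t) - A' (s +i* t)) <= M.
  move=> /andP[s1 s2] /andP[t1 t2].
  have wl : l1norm (s +i* t - w0) <= (a + b) * h.
    rewrite /l1norm /= mulrDl lerD // ler_norml; apply/andP; split; lra.
  have wd : l1norm (s +i* t - w0) < d.
    apply: le_lt_trans wl _; apply: le_lt_trans hd.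
    by rewrite mulrC ler_wpM2l ?(ltW h0) // lerDl.
  have := Hd _ wd; rewrite [w0 + _]addrC subrK /A' opprD addrA => /le_trans; apply.
  by rewrite ler_wpM2l // ltW // divr_gt0.
have HH t0 : y <= t0 <= y + b * h ->
    l1norm (line_integral f (0 +i* t0) 1 x (x + a * h) -
      (A ((x + a * h) +i* t0) - A (x +i* t0))) <= 2 * M * (a * h).
  move=> ht0; have lE (s : R) : (0 +i* t0) + s%:C * 1 = s +i* t0.
    by rewrite mulr1; apply/eqP; rewrite eq_complex /= add0r addr0 !eqxx.
  have := @line_integral_approx f A A' (0 +i* t0) 1 x (x + a * h) M df dA.
  rewrite !lE (_ : x + a * h - x = a * h); last by ring.
  apply; first by rewrite lerDl.
  by move=> s sx; rewrite lE mulr1 close.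
have HV s0 : x <= s0 <= x + a * h ->
    l1norm (line_integral f s0%:C 'i y (y + b * h) -
      (A (s0 +i* (y + b * h)) - A (s0 +i* y))) <= 2 * M * (b * h).
  move=> hs0; have lE (t : R) : s0%:C + t%:C * 'i = s0 +i* t.
    by apply/eqP; rewrite eq_complex /= !mul0r !mulr0 !mulr1 subr0 !addr0 !add0r !eqxx.
  have := @line_integral_approx f A A' s0%:C 'i y (y + b * h) M df dA.
  rewrite !lE (_ : y + b * h - y = b * h); last by ring.
  apply; first by rewrite lerDl.
  move=> t ty; rewrite lE (le_trans (l1normM _ _)) // /l1norm /= normr0 normr1 add0r mulr1.
  exact: close.
have hy : y <= y <= y + b * h by rewrite lexx lerDl.
have hy' : y <= y + b * h <= y + b * h by rewrite lexx lerDl andbT.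
have hx : x <= x <= x + a * h by rewrite lexx lerDl.
have hx' : x <= x + a * h <= x + a * h by rewrite lexx lerDl andbT.
rewrite /P /rect_integral.
have := lerD (lerD (lerD (HH _ hy) (HV _ hx')) (HH _ hy')) (HV _ hx).
set B1 := A _ - A _; set B2 := A _ - A _; set B3 := A _ - A _; set B4 := A _ - A _.
set L1 := line_integral _ _ _ _ _; set L2 := line_integral _ _ _ _ _.
set L3 := line_integral _ _ _ _ _; set L4 := line_integral _ _ _ _ _.
(* The increments of [A] cancel around the closed boundary: [B1 + B2 - B3 - B4 = 0]. *)
move=> H; rewrite (_ : _ - L4 = (L1 - B1) + (L2 - B2) + - (L3 - B3) + - (L4 - B4)); last first.
  by rewrite /B1 /B2 /B3 /B4; ring.
apply: (@le_trans _ _ (l1norm (L1 - B1) + l1norm (L2 - B2) + l1norm (L3 - B3) + l1norm (L4 - B4))).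
  apply: le_trans (l1normD _ _) _; rewrite l1normN lerD2r.
  apply: le_trans (l1normD _ _) _; rewrite l1normN lerD2r.
  exact: l1normD.
apply: le_trans H _.
rewrite (_ : _ + _ = e * h ^+ 2 * ((4 * (a + b) ^+ 2) / k)); last by rewrite /M; field; rewrite gt_eqF.
apply: ler_piMr; first by rewrite mulr_ge0 ?sqr_ge0 // ltW.
by rewrite ler_pdivrMr // mul1r /k lerDl.
Qed.

End Goursat.

(** * Liouville's theorem *)

Section Liouville.
Variable R : realType.
Local Notation C := R[i].
Local Notation Re := (@complex.Re R).
Local Notation Im := (@complex.Im R).

Definition cexp (z : C) : C := (expR (Re z))%:C * (cos (Im z) +i* sin (Im z)).

Lemma cexpD z w : cexp (z + w) = cexp z * cexp w.
Proof.
case: z w => a b [c d]; rewrite /cexp /= expRD cosD sinD rmorphM /=.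
rewrite mulrACA; congr (_ * _).
by apply/eqP; rewrite eq_complex /= eqxx addrC eqxx.
Qed.

Lemma cexp0 : cexp 0 = 1.
Proof. by rewrite /cexp /= expR0 cos0 sin0 mul1r. Qed.

Lemma l1norm_cexp z : l1norm (cexp z) <= 2 * expR (Re z).
Proof.
rewrite /cexp l1norm_realM ger0_norm ?expR_ge0 // mulrC ler_wpM2r ?expR_ge0 //.
by rewrite /l1norm /= lerD // ler_norml ?cos_geN1 ?cos_le1 ?sin_geN1 ?sin_le1.
Qed.

Lemma cexp_cderiv0 : cderiv_at cexp 0 1.
Proof.
move=> e e0.
(* The error terms below add up to at most [k |x| + 5 k |y|], whence [e / 5]; [k <= 1] absorbs the
   product terms. *)
pose k : R := Num.min 1 (e / 5).
have k0 : 0 < k by rewrite lt_min ltr01 divr_gt0.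
have k1 : k <= 1 by rewrite ge_min lexx.
have ke : 5 * k <= e by rewrite mulrC -ler_pdivlMr // ge_min lexx orbT.
have [r1 r10 H1] := (is_derive_epsP _ _ _).1 (is_derive_expR (0 : R)) k k0.
have [r2 r20 H2] := (is_derive_epsP _ _ _).1 (is_derive_cos (0 : R)) k k0.
have [r3 r30 H3] := (is_derive_epsP _ _ _).1 (is_derive_sin (0 : R)) k k0.
exists (Num.min (Num.min r1 r2) (Num.min r3 (k / 2))).
  by rewrite !lt_min r10 r20 r30 divr_gt0.
case=> x y; rewrite !lt_min add0r => /andP[/andP[l1 l2] /andP[l3 l4]].
have xl : `|x| <= l1norm (x +i* y) by rewrite lerDl.
have yl : `|y| <= l1norm (x +i* y) by rewrite lerDr.
have := H1 x (le_lt_trans xl l1); rewrite add0r expR0 mul1r => {}H1.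
have := H2 y (le_lt_trans yl l2); rewrite add0r cos0 sin0 oppr0 mul0r subr0 => {}H2.
have := H3 y (le_lt_trans yl l3); rewrite add0r sin0 cos0 mul1r subr0 => {}H3.
have {xl l4}xk : `|x| <= k / 2 by apply/ltW/(le_lt_trans xl).
have ex : `|expR x - 1| <= k.
  rewrite -[expR x - 1](subrK x); apply: le_trans (ler_normD _ _) _.
  have : k * `|x| <= 1 * `|x| by rewrite ler_wpM2r.
  lra.
have sy : `|sin y| <= 2 * `|y|.
  rewrite -[sin y](subrK y); apply: le_trans (ler_normD _ _) _.
  have : k * `|y| <= 1 * `|y| by rewrite ler_wpM2r.
  lra.
rewrite cexp0 /cexp /l1norm /= !mul0r !mul1r ?oppr0 ?subr0 ?addr0 ?subr0 ?addr0.
rewrite (_ : expR x * cos y - 1 - x =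
  (expR x - 1 - x) + (expR x - 1) * (cos y - 1) + (cos y - 1)); last by ring.
rewrite (_ : expR x * sin y - y = (expR x - 1) * sin y + (sin y - y)); last by ring.
have n1 := ler_normD (expR x - 1 - x + (expR x - 1) * (cos y - 1)) (cos y - 1).
have n2 := ler_normD (expR x - 1 - x) ((expR x - 1) * (cos y - 1)).
have n3 := ler_normD ((expR x - 1) * sin y) (sin y - y).
rewrite normrM in n2; rewrite normrM in n3.
have n4 : `|expR x - 1| * `|cos y - 1| <= 1 * (k * `|y|).
  by rewrite ler_pM // (le_trans ex).
have n5 : `|expR x - 1| * `|sin y| <= k * (2 * `|y|) by rewrite ler_pM.
have n6 : 5 * k * (`|x| + `|y|) <= e * (`|x| + `|y|) by rewrite ler_wpM2r ?addr_ge0.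
have n7 : 0 <= k * `|x| by rewrite mulr_ge0 // ltW.
lra.
Qed.

(** By [cexpD] the error term at [z] is [cexp z] times the one at 0. *)
Lemma cexp_cderiv z : cderiv_at cexp z (cexp z).
Proof.
move=> e e0; have L0 : 0 < l1norm (cexp z) + 1 by rewrite ltr_wpDl ?l1norm_ge0.
have [d d0 H] := cexp_cderiv0 (divr_gt0 e0 L0).
exists d => // h /H; rewrite add0r cexp0 mul1r => Hh.
rewrite cexpD (_ : _ - _ = cexp z * (cexp h - 1 - h)); last by ring.
apply: le_trans (l1normM _ _) _; apply: le_trans (ler_wpM2l (l1norm_ge0 _) Hh) _.
rewrite mulrA ler_wpM2r ?l1norm_ge0 // mulrCA ler_piMr ?ltW //.
by rewrite ltr_pdivrMr // mul1r ltrDl.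
Qed.

Lemma cexp_period z : cexp (z + (0 +i* (pi *+ 2))) = cexp z.
Proof. by rewrite cexpD [X in _ * X]/cexp /= expR0 cos2pi sin2pi mul1r mulr1. Qed.

(* Integrate w |-> g (z + e^w) e^(-w) along {x} x [0, 2 pi]: by Goursat and
   periodicity the value [K x] does not depend on x; it tends to 0 as
   x -> +oo because g is bounded, and to 2 pi i g'(z) as x -> -oo. *)
Lemma Liouville_deriv (g : C -> C) (M : R) z c : entire g -> (forall w, l1norm (g w) <= M) ->
  cderiv_at g z c -> c = 0.
Proof.
move=> dg gM dgz.
(* The factors 1 and -1 and the summand 0 present the inner maps as affine functions, for
   [entire_affine]. *)
pose Phi w := g (z + 1 * cexp w) * cexp (0 + -1 * w).
have dexp : entire cexp by move=> w; exists (cexp w); exact: cexp_cderiv.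
have dPhi : entire Phi.
  apply: (@entireM _ (g \o ((fun u => z + 1 * u) \o cexp)) (cexp \o (fun u => 0 + -1 * u))).
    by apply: entire_comp => //; apply: entire_comp => //; apply: entire_affine.
  by apply: entire_comp => //; apply: entire_affine.
have PhiE w : Phi w = g (z + cexp w) * cexp (- w) by rewrite /Phi mul1r mulN1r add0r.
pose K x := line_integral Phi x%:C 'i 0 (pi *+ 2).
have pi2 : 0 <= pi *+ 2 :> R by rewrite mulrn_wge0 // pi_ge0.
have lE (x t : R) : x%:C + t%:C * 'i = x +i* t.
  by apply/eqP; rewrite eq_complex /= !mul0r !mulr0 !mulr1 subr0 !addr0 !add0r !eqxx.
(* The horizontal sides of the rectangle cancel because [Phi] has period 2 pi i, leaving the two
   vertical ones. *)
have Kconst x y : x <= y -> K x = K y.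
  move=> xy; have := @Goursat _ Phi x 0 (y - x) (pi *+ 2) dPhi _ pi2.
  rewrite subr_ge0 => /(_ xy); rewrite /rect_integral [x + _]addrC subrK add0r.
  have -> : line_integral Phi (0 +i* (pi *+ 2)) 1 x y = line_integral Phi (0 +i* 0) 1 x y.
    have E : (fun t : R => Phi (0 +i* (pi *+ 2) + t%:C * 1) * 1)
           = (fun t : R => Phi (0 +i* 0 + t%:C * 1) * 1).
      apply/funext => t; rewrite !PhiE; congr (g (z + _) * _ * _).
        by rewrite addrC cexp_period add0r.
      rewrite -(cexp_period (- _)); congr cexp.
      by rewrite opprD addrAC [- (0 +i* _)]/= addNr !add0r.
    by rewrite /line_integral E.
  by move=> H; apply/eqP; rewrite eq_sym -subr_eq0; apply/eqP; rewrite -[RHS]H /K; ring.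
have M0 : 0 <= M by rewrite (le_trans _ (gM 0)) ?l1norm_ge0.
have expPhi (x t : R) (u : C) : l1norm (u * cexp (- (x +i* t)) * 'i) <= l1norm u * (2 * expR (- x)).
  apply: le_trans (l1normM _ _) _; rewrite /l1norm /= normr0 normr1 add0r mulr1.
  by apply: le_trans (l1normM _ _) _; rewrite ler_wpM2l ?l1norm_ge0 // l1norm_cexp.
have K0 x : K x = 0.
  apply: (@l1norm_le_eps0 _ _ (2 * (M * 2) * (pi *+ 2 - 0))) => e e0.
  (* Far enough to the right [e^(-y) <= e], so [Phi] is close to 0 there and is compared with the
     antiderivative 0. *)
  rewrite (Kconst x (Num.max x (- ln e))) ?le_max ?lexx //.
  set y := Num.max _ _.
  have := @line_integral_approx _ Phi (fun=> 0 + 0 * 0) (fun=> 0) y%:C 'i 0 (pi *+ 2)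
    (M * (2 * e)) dPhi _ pi2 _.
  rewrite !subr0 subrr subr0 (_ : 2 * (M * (2 * e)) * (pi *+ 2) = 2 * (M * 2) * (pi *+ 2) * e); last by ring.
  apply.
    by move=> w d d0; exists 1 => // h _; rewrite subrr mul0r subr0 l1norm0 mulr_ge0 ?l1norm_ge0 ?ltW.
  move=> t _; rewrite subr0 lE PhiE; apply: le_trans (expPhi _ _ _) _.
  rewrite ler_pM ?l1norm_ge0 ?mulr_ge0 ?expR_ge0 // ler_wpM2l //.
  by rewrite -[leRHS](lnK (x := e)) ?posrE // ler_expR lerNl le_max lexx orbT.
suff : c * (0 +i* (pi *+ 2)) = 0.
  move/eqP; rewrite mulf_eq0 => /orP[/eqP //|]; rewrite eq_complex /= => /andP[_].
  by rewrite mulrn_eq0 /= gt_eqF // pi_gt0.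
apply: (@l1norm_le_eps0 _ _ (2 * 4 * (pi *+ 2 - 0))) => e e0.
have [d d0 Hd] := dgz e e0.
(* Then [l1norm (cexp (x + i t)) <= 2 e^x = d / 2 < d]. *)
pose x := ln (d / 4).
have ex : expR x = d / 4 by rewrite lnK // posrE divr_gt0.
(* [Phi - A'] is the error term of [g] at [z] for the increment [e^w], times [e^(-w)]. Over the
   segment [A] grows by [2 pi i c], its exponential term being periodic. *)
pose A w := (0 + c * w) + (0 + - g z * cexp (0 + -1 * w)).
pose A' w := c + g z * cexp (- w).
have dA w : cderiv_at A w (A' w).
  have dm : cderiv_at (cexp \o (fun u => 0 + -1 * u)) w (cexp (0 + -1 * w) * -1).
    exact: cderiv_at_comp (cexp_cderiv _) (cderiv_at_affine _ _ _).
  have {}dm := cderiv_at_comp (cderiv_at_affine 0 (- g z) _) dm.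
  have da := cderiv_at_affine 0 c w.
  move=> r r0; have r20 : 0 < r / 2 by rewrite divr_gt0.
  have [s1 s10 S1] := dm _ r20; have [s2 s20 S2] := da _ r20.
  exists (Num.min s1 s2); first by rewrite lt_min s10.
  move=> h; rewrite lt_min => /andP[/S1 /= h1 /S2 h2].
  rewrite [r]splitr [leRHS]mulrDl; apply: le_trans (lerD h2 h1).
  apply: le_trans (l1normD _ _); rewrite le_eqVlt; apply/orP; left; apply/eqP.
  by congr l1norm; rewrite /A /A' !add0r !mulN1r; ring.
have := @line_integral_approx _ Phi A A' x%:C 'i 0 (pi *+ 2) (e * 4) dPhi dA pi2 _.
rewrite -/(K x) K0 sub0r l1normN !lE.
have -> : A (x +i* (pi *+ 2)) - A (x +i* 0) = c * (0 +i* (pi *+ 2)).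
  have E : x +i* (pi *+ 2) = (x +i* 0) + (0 +i* (pi *+ 2)).
    by apply/eqP; rewrite eq_complex /= addr0 add0r !eqxx.
  have E2 : cexp (- (x +i* (pi *+ 2))) = cexp (- (x +i* 0)).
    by rewrite -[LHS]cexp_period E opprD -addrA addNr addr0.
  by rewrite /A !add0r !mulN1r E2 E; ring.
rewrite (_ : 2 * (e * 4) = 2 * 4 * e); last by ring.
rewrite [_ * e * _]mulrAC; apply => t _; rewrite lE PhiE /A'.
have cd : l1norm (cexp (x +i* t)) < d.
  apply: le_lt_trans (l1norm_cexp _) _ => /=; rewrite ex; lra.
have -> : g (z + cexp (x +i* t)) * cexp (- (x +i* t)) - (c + g z * cexp (- (x +i* t)))
   = (g (z + cexp (x +i* t)) - g z - c * cexp (x +i* t)) * cexp (- (x +i* t)).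
  rewrite mulrBl mulrBl -[c * _ * _]mulrA -cexpD subrr cexp0; ring.
apply: le_trans (expPhi _ _ _) _.
apply: (@le_trans _ _ (e * (2 * expR x) * (2 * expR (- x)))).
  rewrite ler_wpM2r ?mulr_ge0 ?expR_ge0 //; apply: le_trans (Hd _ cd) _.
  by rewrite ler_wpM2l ?(ltW e0) // l1norm_cexp.
rewrite (_ : _ * _ = e * 4 * (expR x * expR (- x))); last by ring.
by rewrite -expRD subrr expR0 mulr1.
Qed.

End Liouville.

(** * The lattice of integers *)

Section NumberFieldEmbeddings.

(** Artin's argument, by induction on the number of non-zero coefficients: if [tau l y] and
    [tau k0 y] differ, subtracting [tau k0 y] times the relation at [x] from the relation at [y * x]
    removes the term [k0] but not a non-zero term [l]. *)
Lemma rmorphism_independent (F L : fieldType) (n : nat)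
    (tau : 'I_n -> {rmorphism F -> L}) (c : 'I_n -> L) :
  (forall k l, tau k =1 tau l -> k = l) ->
  (forall x, \sum_k c k * tau k x = 0) -> forall k, c k = 0.
Proof.
move=> tau_inj; have [m] := ubnP #|[pred k | c k != 0]|.
elim: m c => // m IH c; rewrite ltnS => cm c0 k0.
apply/eqP/negP => /negP ck0.
have cl l : l != k0 -> c l = 0.
  move=> lk0; apply/eqP/negP => /negP cl.
  have [y] : exists y, tau l y != tau k0 y.
    apply: contrapT => H; move/eqP: lk0; apply; apply: tau_inj => y.
    by apply/eqP/negP => /negP ?; apply: H; exists y.
  rewrite -subr_eq0 => /negP; apply; rewrite -(mulrI_eq0 _ (mulfI cl)); apply/eqP.
  pose c' k := c k * (tau k y - tau k0 y); rewrite -/(c' l); apply: IH => [|x].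
    apply: leq_trans cm; apply: proper_card; apply/properP; split.
      by apply/fintype.subsetP => k; rewrite !inE /c' mulf_eq0 negb_or => /andP[].
    by exists k0; rewrite !inE // /c' subrr mulr0 eqxx.
  transitivity (\sum_k c k * tau k (y * x) - tau k0 y * \sum_k c k * tau k x); last first.
    by rewrite !c0 mulr0 subrr.
  rewrite mulr_sumr -sumrB; apply: eq_bigr => k _.
  by rewrite /c' rmorphM; ring.
have := c0 1; rewrite (bigD1 k0) //= big1 => [|l lk0]; last by rewrite cl // mul0r.
by rewrite addr0 rmorph1 mulr1 => /eqP; apply/negP.
Qed.

Variable K : fieldExtType rat.

Lemma fieldExt_intr_eq0 (z : int) : (z%:~R == 0 :> K) = (z == 0).
Proof. by rewrite -(rmorph_int (GRing.in_alg K)) fmorph_eq0 intr_eq0. Qed.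

(* For [r] of degree [n] with leading coefficient [l], the polynomial
   [l^(n-1) r (X / l)] is monic with integer coefficients. *)
Lemma integral_scale (a : K) (r : {poly int}) :
  root (map_poly intr r) a -> r != 0 -> ring_of_integers ((lead_coef r)%:~R * a).
Proof.
move=> ra r0; set l := lead_coef r.
have [n sr] : exists n, size r = n.+1.
  by exists (size r).-1; rewrite prednK // lt0n size_poly_eq0.
have n0 : (0 < n)%N.
  rewrite lt0n; apply/negP => /eqP n0; move: ra; rewrite n0 in sr.
  have /eqP/size_poly1P [b b0 ->] := sr.
  by rewrite map_polyC /= rootC fieldExt_intr_eq0 (negPf b0).
pose q : {poly int} := \poly_(i < n) (r`_i * l ^+ (n.-1 - i)).
have sq : (size q < size ('X^n : {poly int}))%N by rewrite size_polyXn ltnS size_poly.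
exists ('X^n + q).
  by rewrite monicE lead_coefDl // lead_coefXn.
rewrite rootE rmorphD /= map_polyXn hornerD hornerXn.
have -> : map_poly intr q = \poly_(i < n) ((r`_i)%:~R * l%:~R ^+ (n.-1 - i)) :> {poly K}.
  apply/polyP => i; rewrite coef_map /= !coef_poly; case: ifP => _; last by [].
  by rewrite intrM rmorphXn.
rewrite horner_poly.
have ll : l = r`_n by rewrite /l lead_coefE sr.
have -> : \sum_(i < n) (r`_i)%:~R * l%:~R ^+ (n.-1 - i) * (l%:~R * a) ^+ i
   = l%:~R ^+ n.-1 * \sum_(i < n) (r`_i)%:~R * a ^+ i.
  rewrite mulr_sumr; apply: eq_bigr => i _; rewrite exprMn.
  have /subnK {2}<- : (i <= n.-1)%N by rewrite -ltnS prednK.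
  by rewrite exprD; ring.
have -> : (l%:~R * a) ^+ n = l%:~R ^+ n.-1 * (l%:~R * a ^+ n).
  by rewrite exprMn mulrA -exprSr prednK.
rewrite -mulrDr mulf_eq0; apply/orP; right.
move: ra; rewrite rootE horner_coef size_map_poly_id0; last first.
  by rewrite fieldExt_intr_eq0 lead_coef_eq0.
rewrite sr big_ord_recr /= coef_map /= -ll addrC; congr (_ + _ == 0).
by apply: eq_bigr => i _; rewrite coef_map.
Qed.

(** Clearing denominators in the minimal polynomial gives an integer polynomial, whose leading
    coefficient is the required multiple. *)
Lemma ring_of_integers_multiple (a : K) :
  exists2 d : int, d != 0 & ring_of_integers (d%:~R * a).
Proof.
have /polyOver1P [q Hq] := minPolyOver 1 a.
have := root_minPoly 1 a; rewrite Hq.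
have q0 : q != 0.
  apply/eqP => q0; have := monic_minPoly 1 a.
  by rewrite Hq q0 map_poly0 monicE lead_coef0 eq_sym oner_eq0.
have [r [b b0 qE]] := rat_poly_scale q.
have r0 : r != 0 by apply: contraNneq q0 => r0; rewrite qE r0 map_poly0 scaler0.
move=> ra; exists (lead_coef r); first by rewrite lead_coef_eq0.
apply: integral_scale => //; move: ra.
rewrite qE map_polyZ /= rootZ; last by rewrite scaler_eq0 oner_eq0 orbF invr_eq0 intr_eq0.
rewrite -map_poly_comp; congr (root _ a); apply: eq_map_poly => z /=.
by rewrite -[z%:~R in LHS]/(z%:~R) scaler_int.
Qed.

Lemma integral_basis n : \dim {:K} = n ->
  exists2 e : 'I_n -> K, (forall j, ring_of_integers (e j)) &
    forall x, exists q : 'I_n -> rat, x = \sum_j q j *: e j.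
Proof.
move=> dimK; subst n; pose B := vbasis {:K}.
have H (j : 'I_(\dim {:K})) : exists d : int, d != 0 /\ ring_of_integers (d%:~R * B`_j).
  by have [d d0 dB] := ring_of_integers_multiple B`_j; exists d.
have [d Hd] := choice H.
exists (fun j => (d j)%:~R * B`_j) => [j|x]; first by case: (Hd j).
exists (fun j => coord B j x / (d j)%:~R).
rewrite {1}(coord_vbasis (memvf x)); apply: eq_bigr => j _.
have [d0 _] := Hd j.
by rewrite mulrzl -scaler_int scalerA divfK ?intr_eq0.
Qed.

Lemma rmorph_ratZ (L : fieldType) (f : {rmorphism K -> L}) (q : rat) (x : K) :
  f (q *: x) = ratr q * f x.
Proof. by rewrite -mulr_algl rmorphM; congr (_ * _); exact: (fmorph_eq_rat (f \o in_alg K)). Qed.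

Lemma ring_of_integers_int (z : int) : ring_of_integers (z%:~R : K).
Proof. exact: (@integral_id _ _ (intr : {rmorphism int -> K})). Qed.

Lemma ring_of_integersM (x y : K) :
  ring_of_integers x -> ring_of_integers y -> ring_of_integers (x * y).
Proof. exact: (@integral_mul _ _ (intr : {rmorphism int -> K})). Qed.

Lemma ring_of_integers_sum n (z : 'I_n -> int) (e : 'I_n -> K) :
  (forall j, ring_of_integers (e j)) -> ring_of_integers (\sum_j (z j)%:~R * e j).
Proof.
move=> He; apply: big_ind => [|x y Hx Hy|j _]; first exact: (ring_of_integers_int 0).
  exact: (@integral_add _ _ (intr : {rmorphism int -> K})).
by apply: ring_of_integersM => //; exact: ring_of_integers_int.
Qed.

End NumberFieldEmbeddings.

(** * Cocompactness of the integers and contracting units *)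

Section OTLattice.
Variables (R : realType) (s t : nat) (K : fieldExtType rat).
Variable sigma : 'I_(s + t + t) -> {rmorphism K -> R[i]}.
Hypothesis dimK : \dim {:K} = (s + 2 * t)%N.
Hypothesis sigmaP : ordered_embeddings sigma.
Local Notation Re := (@complex.Re R).
Local Notation Im := (@complex.Im R).

(** The embeddings of an integral Q-basis form an invertible complex matrix, so complex coefficients
    exist; conjugation symmetry makes real ones suffice. *)
Lemma integers_span : exists2 e : 'I_(s + t + t) -> K,
  (forall j, ring_of_integers (e j)) &
  forall x : 'rV[R[i]]_(s + t), (forall i : 'I_s, Im (x 0 (lshift t i)) = 0) ->
    exists c : 'I_(s + t + t) -> R,
      forall k, x 0 k = \sum_j (c j)%:C * coord_emb sigma k (e j).
Proof.
have [|e He span] := @integral_basis K (s + t + t); first by rewrite dimK mul2n -addnn addnA.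
exists e => // x xreal.
pose A := \matrix_(k, j) sigma k (e j).
have uA : A \in unitmx.
  (* A row relation of [A] is a linear relation between the embeddings on a basis, hence on all of
     [K]. *)
  rewrite -row_free_unit; apply: inj_row_free => v vA.
  apply/rowP => k; rewrite mxE.
  apply: (rmorphism_independent (tau := sigma) (c := fun k => v 0 k)) => [|y].
    exact: emb_distinct sigmaP.
  have [q ->] := span y.
  under eq_bigr => l _ do rewrite rmorph_sum mulr_sumr.
  rewrite exchange_big /= big1 // => j _.
  have := congr1 (fun w : 'rV_(s + t + t) => w 0 j) vA; rewrite !mxE => vAj.
  rewrite -[RHS](mulr0 (ratr (q j))) -[X in _ = _ * X]vAj mulr_sumr; apply: eq_bigr => l _.
  by rewrite mxE rmorph_ratZ; ring.
(* [x] completed by the conjugates of its complex coordinates, matching the order of the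
   embeddings. *)
pose X : 'cV[R[i]]_(s + t + t) := \col_k
  match fintype.split k with inl k1 => x 0 k1 | inr j => conjc (x 0 (rshift s j)) end.
pose c := invmx A *m X.
have cX k : \sum_j c j 0 * sigma k (e j) = X k 0.
  rewrite -[X](mulKVmx uA) -/c mxE; apply: eq_bigr => j _.
  by rewrite [A _ _]mxE mulrC.
have X1 k : X (lshift t k) 0 = x 0 k by rewrite mxE (unsplitK (inl k)).
have X2 j : X (rshift (s + t) j) 0 = conjc (x 0 (rshift s j)) by rewrite mxE (unsplitK (inr j)).
exists (fun j => Re (c j 0)) => k.
(* Conjugating the system permutes its equations, so the conjugate coefficients solve it too, and so
   does the average of both solutions. *)
suff E : \sum_j conjc (c j 0) * coord_emb sigma k (e j) = x 0 k.
  have := cX (lshift t k); rewrite X1 -/(coord_emb sigma k) => E1.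
  have two : (2 : R[i]) != 0 by rewrite pnatr_eq0.
  apply: (mulfI two); rewrite mulr_natl mulr2n -{1}E1 -E -big_split mulr_sumr /=.
  by apply: eq_bigr => j _; rewrite -mulrDl addcJ mulrA.
case: (splitP k) => i ki.
  have -> : k = lshift t i by apply: val_inj.
  have real (z : R[i]) : Im z = 0 -> conjc z = z by case: z => a b /= ->; rewrite oppr0.
  have := cX (lshift t (lshift t i)); rewrite X1 => /(congr1 conjc).
  rewrite [RHS]real // rmorph_sum => <-; apply: eq_bigr => j _.
  by rewrite rmorphM [X in _ = _ * X]real //; apply: emb_real sigmaP _ _.
have -> : k = rshift s i by apply: val_inj.
have := cX (rshift (s + t) i); rewrite X2 => /(congr1 conjc).
rewrite conjcK rmorph_sum => <-; apply: eq_bigr => j _.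
by rewrite rmorphM (emb_conj sigmaP).
Qed.

(** The integer parts of the real coordinates give [b], the fractional parts a point of a fixed
    parallelotope. *)
Lemma integers_cocompact : exists2 e : 'I_(s + t + t) -> K,
  (forall j, ring_of_integers (e j)) &
  forall x : 'rV[R[i]]_(s + t), (forall i : 'I_s, Im (x 0 (lshift t i)) = 0) ->
    exists b, ring_of_integers b /\ exists c : 'I_(s + t + t) -> R,
      (forall j, 0 <= c j <= 1) /\
      forall k, x 0 k = coord_emb sigma k b + \sum_j (c j)%:C * coord_emb sigma k (e j).
Proof.
have [e He span] := integers_span; exists e => // x /span [c xE].
exists (\sum_j (Num.floor (c j))%:~R * e j); split; first exact: ring_of_integers_sum.
exists (fun j => c j - (Num.floor (c j))%:~R); split=> [j|k].
  have /andP[f1 f2] := floor_itv (c j); rewrite subr_ge0 f1 lerBlDl /= ltW //.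
  by rewrite intrD in f2; rewrite addrC in f2 *.
rewrite xE rmorph_sum -big_split; apply: eq_bigr => j _ /=.
by rewrite rmorphM rmorphB /= !rmorph_int -mulrDl addrCA subrr addr0.
Qed.

Variable U : set K.
Hypothesis U_adm : admissible sigma U.

(** The logarithms of units form a full lattice, so some unit has its logarithms within a bounded
    distance of any given vector, here one far in the negative orthant. *)
Lemma contracting_unit (d : R) : 0 < d -> exists2 u, U u &
  forall i, 0 < Re (real_emb sigma i u) < d.
Proof.
move=> d0.
have [B uB LB] := adm_lattice U_adm.
(* Rounding changes each lattice coordinate by at most 1, hence each logarithm by at most [M]; the
   further [- 1] below makes the inequality strict. *)
pose M : R := \sum_i \sum_j `|B i j|.
pose y : 'rV[R]_s := const_mx (ln d - M - 1) *m invmx B.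
pose n : 'rV[int]_s := map_mx (@Num.floor R) y.
have : [set map_mx intr n *m B | n in [set: 'rV[int]_s]] (map_mx intr n *m B) by exists n.
rewrite -LB => -[u Uu uE]; exists u => // i.
have [_ pos] := adm_units U_adm Uu.
have := pos i; rewrite ltcE => /andP[_ /= p0]; rewrite p0 /=.
have := congr1 (fun w : 'rV_s => w 0 i) uE; rewrite mxE => lnE.
rewrite -ltr_ln ?posrE // lnE.
have -> : map_mx intr n *m B = const_mx (ln d - M - 1) + (map_mx intr n - y) *m B.
  by rewrite mulmxBl /y -mulmxA mulVmx // mulmx1 addrCA subrr addr0.
rewrite mxE mxE mxE.
apply: (@le_lt_trans _ _ (ln d - M - 1 + M)); last by lra.
rewrite lerD2l (le_trans (ler_norm _)) // (le_trans (ler_norm_sum _ _ _)) //.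
apply: ler_sum => j _.
rewrite (bigD1 i) //= -[X in X <= _]addr0 lerD ?sumr_ge0 //.
rewrite normrM ler_piMl //.
have -> : (map_mx intr n - y) 0 j = (Num.floor (y 0 j))%:~R - y 0 j.
  by rewrite [LHS]mxE [map_mx _ _ _ _]mxE [n 0 j]mxE [(- y) _ _]mxE.
rewrite ler_norml; have := floorD1_gt (y 0 j); have := floor_le (y 0 j).
rewrite intrD; move: (y 0 j) => z f1 f2; apply/andP; split; lra.
Qed.

End OTLattice.

(** * Holomorphic functions invariant under the integers *)

Section ComplexNorm.
Variable R : realType.
Local Notation C := R[i].
Local Notation Re := (@complex.Re R).
Local Notation Im := (@complex.Im R).

Lemma normc_le_l1norm (z : C) : `|z| <= (l1norm z)%:C.
Proof.
rewrite {1}(complexE z); apply: le_trans (ler_normD _ _) _.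
rewrite normrM !normc_def /= !expr0n /= expr1n !addr0 add0r sqrtr1 mul1r.
by rewrite !sqrtr_sqr /l1norm rmorphD.
Qed.

Lemma l1norm_le_normc (z : C) : (l1norm z)%:C <= 2 * `|z|.
Proof.
rewrite normc_def -[2]/(2%:R) -(rmorph_nat (real_complex R)) -rmorphM lecR.
rewrite mulr_natl mulr2n lerD // -[leLHS]ger0_norm // -sqrtr_sqr ler_wsqrtr //.
  by rewrite real_normK ?num_real // lerDl sqr_ge0.
by rewrite real_normK ?num_real // lerDr sqr_ge0.
Qed.

Lemma derivable_cderiv n (f : 'rV[C]_n -> C^o) (y v : 'rV[C]_n) (p : C) :
  derivable f ((y + p *: v) : 'rV[C : numFieldType]_n) v ->
  exists c, cderiv_at (fun z => f (y + z *: v)) p c.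
Proof.
move=> /cvg_ex [c /= Hc]; exists c => e e0.
have e20 : 0 < (e / 2)%:C by rewrite ltcR divr_gt0.
move/cvgrPdist_le : Hc => /(_ _ e20).
(* The radius lies in [R[i]]; being positive, it is the real number [d1]. *)
rewrite ?near_simpl => /nbhs_ballP [[d1 d2] /=]; rewrite ltcE /= => /andP[/eqP d20 d10] Hd.
exists d1 => // h hd; have [->|h0] := eqVneq h 0.
  by rewrite addr0 subrr mulr0 subr0 l1norm0 mulr0.
have hb : ball (0 : (C : numFieldType)) (d1 +i* d2) h.
  rewrite /ball /= sub0r normrN d20; apply: le_lt_trans (normc_le_l1norm _) _.
  by rewrite ltcR.
have := Hd h hb h0.
rewrite [h *: v + _]addrC -addrA -scalerDl => Hh.
rewrite -lecR; apply: le_trans (l1norm_le_normc _) _.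
have alg (A B D : C) : A - B - D * h = - h * (D - h^-1 * (A - B)) by field.
rewrite alg.
rewrite normrM normrN rmorphM /=.
apply: le_trans (_ : 2 * (`|h| * (e / 2)%:C) <= _).
  by rewrite ler_wpM2l // ler_wpM2l.
rewrite (_ : 2 * _ = e%:C * `|h|).
  by rewrite ler_wpM2l ?ler0c ?(ltW e0) // normc_le_l1norm.
by rewrite rmorphM fmorphV rmorph_nat mulrCA [2 * _]mulrC divfK ?pnatr_eq0 // mulrC.
Qed.

Lemma l1norm_continuous n (f : 'rV[C]_n -> C^o) (y : 'rV[C]_n) :
  f @ (y : 'rV[C : numFieldType]_n) --> f y ->
  forall e : R, 0 < e -> exists2 d : R, 0 < d &
    forall y' : 'rV[C]_n, (forall k, l1norm (y' 0 k - y 0 k) < d) -> l1norm (f y' - f y) <= e.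
Proof.
move=> cf e e0.
have e20 : 0 < (e / 2)%:C by rewrite ltcR divr_gt0.
move/cvgrPdist_le : cf => /(_ _ e20).
rewrite ?near_simpl => cf.
have /nbhs_ballP [[d1 d2] /=] : nbhs (y : 'rV[C : numFieldType]_n) [set x | `|f y - f x| <= (e / 2)%:C].
  exact: cf.
rewrite ltcE /= => /andP[/eqP d20 d10] Hd.
exists d1 => // y' Hy'.
have /Hd H : ball (y : 'rV[C : numFieldType]_n) (d1 +i* d2) y'.
  split; first by rewrite ltcE /= d20 eqxx.
  move=> i j; rewrite (ord1 i) /ball /= distrC d20.
  by apply: le_lt_trans (normc_le_l1norm _) _; rewrite ltcR.
rewrite -lecR l1normB; apply: le_trans (l1norm_le_normc _) _.
rewrite (_ : e%:C = 2 * (e / 2)%:C); first by rewrite ler_wpM2l.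
by rewrite rmorphM fmorphV rmorph_nat mulrC divfK ?pnatr_eq0.
Qed.

(** Compactness of the cube, in the covering form with a parameter [M] tending to infinity: near
    each point all large [M] are upper bounds. *)
Lemma unit_cube_bounded n (phi : 'rV[R]_n -> R) :
  (forall c : 'rV[R]_n, (forall j, 0 <= c 0 j <= 1) -> exists2 d : R, 0 < d &
    forall c' : 'rV[R]_n, (forall j, `|c' 0 j - c 0 j| < d) -> phi c' <= phi c + 1) ->
  exists M, forall c : 'rV[R]_n, (forall j, 0 <= c 0 j <= 1) -> phi c <= M.
Proof.
move=> loc.
have /compact_near_coveringP cpt := @rV_compact R n (fun=> `[0, 1]%classic)
  (fun=> @segment_compact R 0 1).
have [|M [_ HM]] := cpt R (pinfty_nbhs R) (fun M c => phi c <= M) _ _.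
  move=> c Hc; have [j|d d0 Hd] := loc c; first by have := Hc j; rewrite /= in_itv.
  exists ([set c' | phi c' <= phi c + 1], [set M | phi c + 1 < M]) => /=; last first.
    by move=> [c' M] /= [h1 h2]; rewrite (le_trans h1) // ltW.
  split; last by exists (phi c + 1); split; rewrite ?num_real.
  apply/nbhs_ballP; exists d => // c' [_ Hc']; apply: Hd => j.
  by have := Hc' 0 j; rewrite /ball /= distrC.
exists (M + 1) => c Hc; apply: (HM (M + 1)); first by rewrite ltrDl.
by move=> j; rewrite /= in_itv; apply: Hc.
Qed.

End ComplexNorm.

(** * From invariance under the integers to constancy *)

Section EquivariantFunctions.
Variables (R : realType) (s t : nat) (K : fieldExtType rat).
Variable sigma : 'I_(s + t + t) -> {rmorphism K -> R[i]}.
Hypothesis dimK : \dim {:K} = (s + 2 * t)%N.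
Hypothesis sigmaP : ordered_embeddings sigma.
Variable U : set K.
Hypothesis U_adm : admissible sigma U.
Local Notation C := R[i].
Local Notation Re := (@complex.Re R).
Local Notation Im := (@complex.Im R).

Variable F : 'rV[C]_(s + t) -> C^o.
Hypothesis F_derivable : forall x v : 'rV[C]_(s + t), OT_domain x ->
  derivable F (x : 'rV[C : numFieldType]_(s + t)) v.
Hypothesis F_continuous : forall x : 'rV[C]_(s + t), OT_domain x ->
  F @ (x : 'rV[C : numFieldType]_(s + t)) --> F x.

Definition emb_row (b : K) : 'rV[C]_(s + t) := \row_k coord_emb sigma k b.

Hypothesis F_transl : forall (b : K) x, ring_of_integers b -> OT_domain x ->
  F (x + emb_row b) = F x.

(** The subspace R^s x C^t, whose translations preserve [OT_domain]. *)
Definition real_part_direction (v : 'rV[C]_(s + t)) :=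
  forall i : 'I_s, Im (v 0 (lshift t i)) = 0.

Lemma OT_domainD (x v : 'rV[C]_(s + t)) :
  OT_domain x -> real_part_direction v -> OT_domain (x + v).
Proof. by move=> dx rv i; rewrite mxE raddfD /= rv addr0; apply: dx. Qed.

Lemma real_part_directionZ (a : R) (v : 'rV[C]_(s + t)) : real_part_direction v -> real_part_direction (a%:C *: v).
Proof. by move=> rv i; rewrite mxE; case: (v _ _) (rv i) => c d /= ->; rewrite mulr0 mul0r addr0. Qed.

Lemma emb_row_real b : real_part_direction (emb_row b).
Proof. by move=> i; rewrite mxE; apply: emb_real sigmaP _ _. Qed.

Lemma holo_line (x v : 'rV[C]_(s + t)) p : OT_domain (x + p *: v) ->
  exists c, cderiv_at (fun z => F (x + z *: v)) p c.
Proof. by move=> dx; apply: derivable_cderiv; apply: F_derivable. Qed.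

(** Modulo translations by integers, [v] lies in the image [w] of a unit cube, where continuity of
    [F] gives a bound. *)
Lemma F_bounded (x : 'rV[C]_(s + t)) : OT_domain x ->
  exists M, forall v, real_part_direction v -> l1norm (F (x + v)) <= M.
Proof.
move=> dx; have [e He cocpt] := integers_cocompact dimK sigmaP.
pose w (c : 'rV[R]_(s + t + t)) := \sum_j (c 0 j)%:C *: emb_row (e j).
have wreal c : real_part_direction (w c).
  move=> i; rewrite summxE raddf_sum big1 // => j _.
  exact: (real_part_directionZ _ (emb_row_real _)).
pose L : R := \sum_j \sum_k l1norm (emb_row (e j) 0 k).
have L0 : 0 <= L by rewrite sumr_ge0 // => j _; rewrite sumr_ge0 // => k _; apply: l1norm_ge0.
have [|M HM] := @unit_cube_bounded R _ (fun c => l1norm (F (x + w c))).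
  move=> c _; have := F_continuous (OT_domainD dx (wreal c)).
  move=> /l1norm_continuous /(_ 1 ltr01) [d d0 Hd].
  (* Moving each [c j] by less than this moves every coordinate of [w c] by less than [d]. *)
  exists (d / (L + 1)); first by rewrite divr_gt0 // ltr_wpDl.
  move=> c' Hc'; rewrite -[F (x + w c')](subrK (F (x + w c))) addrC.
  apply: le_trans (l1normD _ _) _; rewrite lerD2l; apply: Hd => k.
  have -> : (x + w c') 0 k - (x + w c) 0 k = \sum_j (c' 0 j - c 0 j)%:C * emb_row (e j) 0 k.
    rewrite !mxE opprD addrACA subrr add0r !summxE -sumrB; apply: eq_bigr => j _.
    by rewrite mxE [X in _ - X]mxE rmorphB mulrBl.
  apply: (@le_lt_trans _ _ (\sum_j d / (L + 1) * l1norm (emb_row (e j) 0 k))).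
    elim/big_ind2: _ => [|a a' b b' h1 h2|j _]; first by rewrite l1norm0.
      by apply: le_trans (l1normD _ _) _; apply: lerD.
    by rewrite l1norm_realM ler_wpM2r ?l1norm_ge0 // ltW.
  rewrite -mulr_sumr; apply: (@le_lt_trans _ _ (d / (L + 1) * L)).
    rewrite ler_wpM2l ?divr_ge0 ?(ltW d0) ?addr_ge0 //; apply: ler_sum => j _.
    by rewrite (bigD1 k) //= lerDl sumr_ge0 // => l _; apply: l1norm_ge0.
  by rewrite mulrAC ltr_pdivrMr ?ltr_wpDl // ltr_pM2l // ltrDl.
exists M => v /cocpt [b [Hb [c [c01 vE]]]].
have -> : v = w (\row_j c j) + emb_row b.
  apply/rowP => k; rewrite vE addrC 2![in RHS]mxE summxE; congr (_ + _).
  by apply: eq_bigr => j _; rewrite !mxE.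
rewrite addrA F_transl //; last exact: OT_domainD.
by apply: HM => j; rewrite mxE.
Qed.

(** The complex line through [x] in direction [v] stays in the domain, and [F] is entire and bounded
    on it, so Liouville applies. *)
Lemma F_complex_direction (x v : 'rV[C]_(s + t)) : OT_domain x -> (forall i : 'I_s, v 0 (lshift t i) = 0) ->
  F (x + v) = F x.
Proof.
move=> dx v0; have rv z : real_part_direction (z *: v) by move=> i; rewrite mxE v0 mulr0.
pose g z := F (x + z *: v).
have dg : entire g by move=> p; apply: holo_line; apply: OT_domainD.
have [M HM] := F_bounded dx.
have dg0 p : cderiv_at g p 0.
  have [c Hc] := dg p.
  by rewrite -(Liouville_deriv dg (fun w => HM _ (rv w)) Hc).
by have := @cderiv0_segment _ g 0 1 (fun r _ => dg0 _); rewrite /g add0r scale1r scale0r addr0.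
Qed.

Definition real_vector (r : 'rV[C]_(s + t)) :=
  real_part_direction r /\ forall j : 'I_t, r 0 (rshift s j) = 0.

(** An integer [b] approximates [r / u] with an error bounded independently of [u]; multiplied by a
    small unit [u], the error shrinks and [u * b] approximates [r]. *)
Lemma F_real_translation (x r : 'rV[C]_(s + t)) : OT_domain x -> real_vector r -> F (x + r) = F x.
Proof.
move=> dx [rr r0]; apply/eqP; rewrite -subr_eq0; apply/eqP.
apply: (@l1norm_le_eps0 _ _ 1) => eps eps0; rewrite mul1r.
have [d d0 Hd] := l1norm_continuous (F_continuous (OT_domainD dx rr)) eps0.
have [e He cocpt] := integers_cocompact dimK sigmaP.
pose L : R := \sum_j \sum_k l1norm (emb_row (e j) 0 k).
have L0 : 0 <= L by rewrite sumr_ge0 // => j _; rewrite sumr_ge0 // => k _; apply: l1norm_ge0.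
have L1 : 0 < L + 1 by rewrite ltr_wpDl.
have [u Uu u_small] := contracting_unit U_adm (divr_gt0 d0 L1).
have realE i a : real_emb sigma i a = (Re (real_emb sigma i a))%:C.
  by have := emb_real sigmaP i a; case: (real_emb _ _ _) => a1 a2 /= ->.
have u0 i : Re (real_emb sigma i u) != 0 by have /andP[h _] := u_small i; rewrite gt_eqF.
pose r' : 'rV[C]_(s + t) := \row_k
  match fintype.split k with inl i => (Re (r 0 (lshift t i)) / Re (real_emb sigma i u))%:C
  | inr _ => 0 end.
have r'E i : r' 0 (lshift t i) = (Re (r 0 (lshift t i)) / Re (real_emb sigma i u))%:C.
  by rewrite mxE (unsplitK (inl i)).
have [i|b [Hb [c [c01 bE]]]] := cocpt r'; first by rewrite r'E.
have Hub : ring_of_integers (u * b).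
  by apply: ring_of_integersM => //; have [[]] := adm_units U_adm Uu.
(* The real coordinates of [emb_row (u * b)]. The discarded ones lie in C^t, where [F] does not see
   them. *)
pose w : 'rV[C]_(s + t) := \row_k
  match fintype.split k with inl i => real_emb sigma i (u * b) | inr _ => 0 end.
have wE i : w 0 (lshift t i) = real_emb sigma i (u * b) by rewrite mxE (unsplitK (inl i)).
have wE' j : w 0 (rshift s j) = 0 by rewrite mxE (unsplitK (inr j)).
have wr : real_part_direction w by move=> i; rewrite wE; apply: emb_real sigmaP _ _.
have -> : F x = F (x + w).
  rewrite -(F_transl Hub dx) -[RHS](@F_complex_direction _ (emb_row (u * b) - w)).
  - by rewrite -addrA [w + _]addrC subrK.
  - exact: OT_domainD.
  - by move=> i; rewrite [LHS]mxE [X in _ + X]mxE wE mxE subrr.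
rewrite l1normB; apply: Hd => k.
rewrite -(splitK k); case: (fintype.split k) => i /=; last first.
  by rewrite !mxE -/(w 0 _) (unsplitK (inr i)) r0 !addr0 subrr l1norm0.
have -> : (x + w) 0 (lshift t i) - (x + r) 0 (lshift t i)
   = - (Re (real_emb sigma i u))%:C * \sum_j (c j)%:C * emb_row (e j) 0 (lshift t i).
  have -> : \sum_j (c j)%:C * emb_row (e j) 0 (lshift t i)
     = r' 0 (lshift t i) - real_emb sigma i b.
    rewrite bE -/(real_emb sigma i) addrAC subrr add0r.
    by apply: eq_bigr => j _; rewrite mxE.
  rewrite r'E mxE [(x + r) _ _]mxE wE rmorphM [real_emb sigma i u]realE /=.
  have -> : r 0 (lshift t i) = (Re (r 0 (lshift t i)))%:C.
    by have := rr i; case: (r _ _) => a1 a2 /= ->.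
  rewrite fmorph_div /=.
  have : (Re (real_emb sigma i u))%:C != 0 by rewrite fmorph_eq0.
  by move: (_%:C) (_%:C) => p q q0 /=; field.
have /andP[u1 u2] := u_small i.
rewrite -rmorphN l1norm_realM normrN gtr0_norm //.
apply: (@le_lt_trans _ _ (Re (real_emb sigma i u) * L)).
  rewrite ler_wpM2l ?(ltW u1) //.
  apply: (@le_trans _ _ (\sum_j l1norm (emb_row (e j) 0 (lshift t i)))).
    elim/big_ind2: _ => [|a a' b1 b' h1 h2|j _]; first by rewrite l1norm0.
      by apply: le_trans (l1normD _ _) _; apply: lerD.
    have /andP[c0 c1] := c01 j.
    by rewrite l1norm_realM ger0_norm // ler_piMl ?l1norm_ge0.
  apply: ler_sum => j _.
  by rewrite (bigD1 (lshift t i)) //= lerDl sumr_ge0 // => l _; apply: l1norm_ge0.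
apply: (@le_lt_trans _ _ (d / (L + 1) * L)); first by rewrite ler_wpM2r // ltW.
by rewrite mulrAC ltr_pdivrMr // ltr_pM2l // ltrDl.
Qed.

(** The complex derivative can be tested on real increments, along which [F] is unchanged; the
    single increment [d / 2] suffices for each [e]. *)
Lemma F_real_direction (x r : 'rV[C]_(s + t)) p : OT_domain (x + p *: r) -> real_vector r ->
  cderiv_at (fun z => F (x + z *: r)) p 0.
Proof.
move=> dx rr; have [c Hc] := holo_line dx; suff <- : c = 0 by [].
apply: (@l1norm_le_eps0 _ _ 1) => e e0; rewrite mul1r.
have [d d0 Hd] := Hc e e0; have d20 : 0 < d / 2 by rewrite divr_gt0.
have nh : l1norm (d / 2)%:C = d / 2 by rewrite /l1norm /= normr0 addr0 gtr0_norm.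
have rv : real_vector ((d / 2)%:C *: r).
  case: rr => rr r0; split; first exact: real_part_directionZ.
  by move=> j; rewrite mxE r0 mulr0.
have := Hd (d / 2)%:C; rewrite nh scalerDl addrA (F_real_translation dx rv).
rewrite subrr sub0r l1normN [c * _]mulrC l1norm_realM gtr0_norm //.
by rewrite [e * _]mulrC ler_pM2l //; apply; lra.
Qed.

(** The point [x] is moved to [y] in three stages: the real parts of the first [s] coordinates, then
    their imaginary parts along a segment of zero derivative, then the coordinates in C^t. *)
Lemma F_constant (x y : 'rV[C]_(s + t)) : OT_domain x -> OT_domain y -> F y = F x.
Proof.
move=> dx dy.
pose part (f : C -> R) : 'rV[C]_(s + t) := \row_k
  match fintype.split k with inl i => (f (y 0 k - x 0 k))%:C | inr _ => 0 end.
pose a := part Re; pose b := part Im.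
have partE f i : part f 0 (lshift t i) = (f (y 0 (lshift t i) - x 0 (lshift t i)))%:C.
  by rewrite mxE (unsplitK (inl i)).
have partE' f j : part f 0 (rshift s j) = 0 by rewrite mxE (unsplitK (inr j)).
have part_real f : real_vector (part f).
  by split=> [i|j]; rewrite ?partE ?partE'.
have dxa : OT_domain (x + a) by apply: OT_domainD => //; case: (part_real Re).
(* On the segment the imaginary parts are convex combinations of those of [x] and [y], hence
   positive. *)
have dxab (r : R) : 0 <= r <= 1 -> OT_domain (x + a + (0 + r%:C * 'i) *: b).
  move=> /andP[r0 r1] i; have := dx i; have := dy i.
  have -> : (x + a + (0 + r%:C * 'i) *: b) 0 (lshift t i) = x 0 (lshift t i)
      + (Re (y 0 (lshift t i) - x 0 (lshift t i)))%:C
      + r%:C * 'i * (Im (y 0 (lshift t i) - x 0 (lshift t i)))%:C.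
    by rewrite -!partE -/a -/b add0r [LHS]mxE [(x + a) _ _]mxE [(_ *: b) _ _]mxE.
  case: (x _ _) (y _ _) => x1 x2 [y1 y2] /= y20 x20.
  rewrite (_ : _ + _ = (1 - r) * x2 + r * y2); last by ring.
  have [->|rneq1] := eqVneq r 1; first by rewrite subrr mul0r add0r mul1r.
  by rewrite ltr_wpDr ?mulr_ge0 ?(ltW y20) // mulr_gt0 // subr_gt0 lt_neqAle rneq1.
rewrite -(F_real_translation dx (part_real Re)) -/a.
have <- : F (x + a + 'i *: b) = F (x + a).
  have := @cderiv0_segment _ (fun z => F (x + a + z *: b)) 0 'i.
  rewrite add0r scale0r addr0; apply => r /dxab d.
  by apply: F_real_direction => //; exact: part_real.
rewrite -(@F_complex_direction (x + a + 'i *: b) (y - (x + a + 'i *: b))).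
- by rewrite addrC subrK.
- by have := dxab 1; rewrite add0r rmorph1 mul1r; apply; rewrite ler01 lexx.
- move=> i; rewrite [LHS]mxE [X in _ + X]mxE [(x + a + 'i *: b) _ _]mxE [(x + a) _ _]mxE [(_ *: b) _ _]mxE.
  rewrite /a /b !partE; apply/eqP; rewrite subr_eq0; apply/eqP.
  by rewrite -addrA -complexE addrC subrK.
Qed.

End EquivariantFunctions.

(** * Sections as equivariant functions *)

Section Sections.
Variables (R : realType) (s t : nat) (K : fieldExtType rat).
Variable sigma : 'I_(s + t + t) -> {rmorphism K -> R[i]}.
Hypothesis s_gt0 : (0 < s)%N.
Hypothesis sigmaP : ordered_embeddings sigma.
Variable U : set K.
Hypothesis U_adm : admissible sigma U.
Variable rho : K -> R[i].
Hypothesis rhoP : character U rho.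
Local Notation C := R[i].
Local Notation Re := (@complex.Re R).
Local Notation Im := (@complex.Im R).

Lemma rho1 : rho 1 = 1.
Proof.
have [rho_neq0 rhoM] := rhoP; have [U1 _ _] := adm_subgroup U_adm.
by apply: (mulfI (rho_neq0 1 U1)); rewrite -rhoM // !mulr1.
Qed.

Lemma OT_act1 (x : 'rV[C]_(s + t)) : OT_act sigma (1, 0) x = x.
Proof. by apply/rowP => k; rewrite mxE /= rmorph1 rmorph0 mul1r addr0. Qed.

Lemma OT_actM u b v c (x : 'rV[C]_(s + t)) :
  OT_act sigma (u, b) (OT_act sigma (v, c) x) = OT_act sigma (u * v, u * c + b) x.
Proof. by apply/rowP => k; rewrite !mxE /= rmorphD !rmorphM mulrDr mulrA addrA. Qed.

Lemma OT_group1 : OT_group U (1, 0).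
Proof.
have [U1 _ _] := adm_subgroup U_adm; split => //=.
exact: (ring_of_integers_int K 0).
Qed.

Lemma OT_groupM u b v c : OT_group U (u, b) -> OT_group U (v, c) ->
  OT_group U (u * v, u * c + b).
Proof.
move=> [/= Uu Ob] [/= Uv Oc]; have [_ UM _] := adm_subgroup U_adm.
split => /=; first exact: UM.
apply: (@integral_add _ _ (intr : {rmorphism int -> K})) => //.
by apply: ring_of_integersM => //; have [[]] := adm_units U_adm Uu.
Qed.

Lemma OT_groupV u b : OT_group U (u, b) -> OT_group U (u^-1, - (u^-1 * b)).
Proof.
move=> [/= Uu Ob]; have [_ _ UV] := adm_subgroup U_adm.
split => /=; first exact: UV.
apply: (@integral_opp _ _ (intr : {rmorphism int -> K})).
by apply: ring_of_integersM => //; have [[]] := adm_units U_adm Uu.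
Qed.

Lemma U_neq0 u : U u -> u != 0.
Proof. by move=> Uu; have [[]] := adm_units U_adm Uu. Qed.

Lemma line_actM u b v c (p : 'rV[C]_(s + t) * C) : U u -> U v ->
  line_act sigma rho (u, b) (line_act sigma rho (v, c) p)
  = line_act sigma rho (u * v, u * c + b) p.
Proof. by move=> Uu Uv; rewrite /line_act /= OT_actM (rhoP.2 _ _ Uu Uv) mulrA. Qed.

Lemma line_orbit_act g (p : 'rV[C]_(s + t) * C) : OT_group U g ->
  line_orbit sigma U rho (line_act sigma rho g p) = line_orbit sigma U rho p.
Proof.
case: g => u b Hg; have [/= Uu _] := Hg; apply/seteqP; split => _ [[v c] Hh <-].
  have [/= Uv _] := Hh.
  by exists (v * u, v * b + c); rewrite ?line_actM //; exact: OT_groupM.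
have [/= Uv _] := Hh; have HV := OT_groupV Hg; have [/= UV _] := HV.
exists (v * u^-1, v * - (u^-1 * b) + c); first exact: OT_groupM.
have [_ UM _] := adm_subgroup U_adm.
rewrite line_actM //; last exact: UM.
congr (line_act _ _ (_, _) _).
  by rewrite mulfVK ?U_neq0.
by rewrite mulrN !mulrA addrA subrr add0r.
Qed.

Lemma OT_orbit_act g (x : 'rV[C]_(s + t)) : OT_group U g ->
  OT_orbit sigma U (OT_act sigma g x) = OT_orbit sigma U x.
Proof.
(* Orbits in the base are projections of orbits in the zero section, so [line_orbit_act] applies. *)
move=> Hg; have E y : OT_orbit sigma U y = fst @` line_orbit sigma U rho (y, 0).
  by rewrite /OT_orbit /line_orbit image_comp.
rewrite !E; congr (_ @` _).
by rewrite -(line_orbit_act (x, 0) Hg) /line_act /= mulr0.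
Qed.

(** An element fixing [x] has [sigma_i u = 1], as comparing imaginary parts in one coordinate of H^s
    shows; so [u = 1] and the fibre is fixed pointwise. This is where [s > 0] enters. *)
Lemma line_orbit_inj (x : 'rV[C]_(s + t)) c c' : OT_domain x ->
  line_orbit sigma U rho (x, c) = line_orbit sigma U rho (x, c') -> c = c'.
Proof.
move=> dx E; have : line_orbit sigma U rho (x, c) (x, c).
  by exists (1, 0); [exact: OT_group1|rewrite /line_act /= OT_act1 rho1 mul1r].
rewrite E => -[[u b] [/= Uu _]] [xE <-]; suff -> : u = 1 by rewrite rho1 mul1r.
pose i := Ordinal s_gt0.
have := congr1 (fun y : 'rV_(s + t) => Im (y 0 (lshift t i))) xE.
have := dx i; rewrite mxE /=.
have := emb_real sigmaP i u; have := emb_real sigmaP i b.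
rewrite /real_emb; case Ei: (coord_emb _ _ u) => [a1 a2] /=.
case: (coord_emb _ _ b) => b1 b2 /= -> a20; case: (x _ _) => x1 x2 /= x20.
rewrite a20 mul0r !addr0 => /eqP; rewrite -subr_eq0 -{2}[x2]mul1r -mulrBl mulf_eq0.
rewrite [x2 == 0]gt_eqF // orbF subr_eq0 => /eqP a11.
by apply/eqP; rewrite -(fmorph_eq1 (coord_emb sigma (lshift t i))) Ei a11 a20.
Qed.

Lemma OT_domain_act u b (x : 'rV[C]_(s + t)) : U u -> OT_domain x ->
  OT_domain (OT_act sigma (u, b) x).
Proof.
move=> Uu dx i; rewrite mxE /=; have [_ /(_ i)] := adm_units U_adm Uu.
have := emb_real sigmaP i b; have := dx i; rewrite /real_emb ltcE.
case: (x _ _) => x1 x2; case: (coord_emb _ _ u) => u1 u2; case: (coord_emb _ _ b) => b1 b2 /=.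
by move=> x20 -> /andP[/eqP -> u10]; rewrite mul0r !addr0 mulr_gt0.
Qed.

(* The value is unique on [OT_domain] because the action on H^s x C^t is free. *)
Definition section_function sec (x : 'rV[C]_(s + t)) : C^o :=
  xget 0 [set c | sec (OT_orbit sigma U x) = line_orbit sigma U rho (x, c)].

Variable sec : set 'rV[C]_(s + t) -> set ('rV[C]_(s + t) * C).
Hypothesis sec_holo : holomorphic_section sigma U rho sec.

Lemma section_functionE x c : OT_domain x ->
  sec (OT_orbit sigma U x) = line_orbit sigma U rho (x, c) -> section_function sec x = c.
Proof.
move=> dx H; rewrite /section_function; case: xgetP => [c' -> /= H'|/(_ c)//].
by apply: (line_orbit_inj dx); rewrite -H.
Qed.

Lemma section_functionP x : OT_domain x ->
  sec (OT_orbit sigma U x) = line_orbit sigma U rho (x, section_function sec x).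
Proof.
move=> dx; have [f _ /nbhs_singleton H] := section_holomorphic sec_holo dx.
by rewrite (section_functionE dx H).
Qed.

Lemma section_function_equivariant u b x : U u -> ring_of_integers b -> OT_domain x ->
  section_function sec (OT_act sigma (u, b) x) = rho u * section_function sec x.
Proof.
move=> Uu Ob dx; apply: section_functionE; first exact: OT_domain_act.
rewrite OT_orbit_act // section_functionP //.
by rewrite -(@line_orbit_act (u, b) (x, section_function sec x)).
Qed.

Lemma OT_domain_near (x : 'rV[C]_(s + t)) : OT_domain x ->
  \forall y \near (x : 'rV[C : numFieldType]_(s + t)), OT_domain y.
Proof.
move=> dx; pose P i (y : 'rV[C]_(s + t)) := 0 < Im (y 0 (lshift t i)).
suff : \forall y \near (x : 'rV[C : numFieldType]_(s + t)), forall i, P i y by [].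
apply: (@filter_forall _ _ P (nbhs (x : 'rV[C : numFieldType]_(s + t))) _) => i; pose d := Im (x 0 (lshift t i)).
apply/nbhs_ballP; exists (d%:C); first by rewrite /= ltcR; exact: dx.
move=> y [_ /(_ 0 (lshift t i))]; rewrite /ball /= normc_def ltcR => H.
have : `|Im (x 0 (lshift t i)) - Im (y 0 (lshift t i))| < d.
  apply: le_lt_trans H; rewrite raddfB /= -[leLHS]ger0_norm // -sqrtr_sqr ler_wsqrtr //.
  by rewrite real_normK ?num_real // raddfB /= lerDr sqr_ge0.
by rewrite /P /d ltr_norml => /andP[_]; lra.
Qed.

(** Uniqueness of fibre coordinates identifies the local holomorphic expressions of [sec] with the
    global function, which inherits their regularity. *)
Lemma section_function_local (x : 'rV[C]_(s + t)) : OT_domain x ->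
  exists2 f : 'rV[C]_(s + t) -> C^o, differentiable f (x : 'rV[C : numFieldType]_(s + t)) &
    \forall y \near (x : 'rV[C : numFieldType]_(s + t)), f y = section_function sec y.
Proof.
move=> dx; have [f fdiff fE] := section_holomorphic sec_holo dx.
exists f; first exact: nbhs_singleton fdiff.
near=> y; apply/esym/section_functionE; first by near: y; exact: OT_domain_near.
by near: y; exact: fE.
Unshelve. all: by end_near. Qed.

Lemma section_function_derivable (x v : 'rV[C]_(s + t)) : OT_domain x ->
  derivable (section_function sec) (x : 'rV[C : numFieldType]_(s + t)) v.
Proof.
move=> dx; have [f df fE] := section_function_local dx.
by apply: near_eq_derivable fE _; apply: diff_derivable.
Qed.

Lemma section_function_continuous (x : 'rV[C]_(s + t)) : OT_domain x ->
  (section_function sec) @ (x : 'rV[C : numFieldType]_(s + t)) --> (section_function sec) x.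
Proof.
move=> dx; have [f df fE] := section_function_local dx.
have fx := nbhs_singleton fE; rewrite -fx.
apply: cvg_trans (differentiable_continuous df).
exact: near_eq_cvg fE.
Qed.

End Sections.

Theorem corollary1p4 (R : realType) (s t : nat) (s_gt0 : (0 < s)%N)
    (t_gt0 : (0 < t)%N) (K : fieldExtType rat)
    (dimK : \dim {:K} = (s + 2 * t)%N)
    (sigma : 'I_(s + t + t) -> {rmorphism K -> R[i]})
    (sigmaP : ordered_embeddings sigma)
    (U : set K) (U_adm : admissible sigma U)
    (rho : K -> R[i]) (rhoP : character U rho) :
  (exists sec, holomorphic_section sigma U rho sec /\
               nonzero_section sigma U rho sec) <->
  (forall u, U u -> rho u = 1).
Proof.
split=> [[sec [sec_holo [x dx x_neq0]]] u Uu|rho_triv].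
- pose F : 'rV[R[i]]_(s + t) -> R[i]^o := section_function sigma U rho sec.
  have F_equiv u' b y : U u' -> ring_of_integers b -> OT_domain y ->
      F (OT_act sigma (u', b) y) = rho u' * F y.
    exact: section_function_equivariant.
  have [U1 _ _] := adm_subgroup U_adm.
  have F_transl b y : ring_of_integers b -> OT_domain y -> F (y + emb_row sigma b) = F y.
    (* Translation by [b] is the action of [(1, b)]. *)
    move=> Ob dy; have := F_equiv 1 b y U1 Ob dy; rewrite (rho1 U_adm rhoP) mul1r => <-.
    by congr F; apply/rowP => k; rewrite !mxE /= rmorph1 mul1r.
  have F_const y z := F_constant dimK sigmaP U_adm
    (section_function_derivable s_gt0 sigmaP U_adm rhoP sec_holo)
    (section_function_continuous s_gt0 sigmaP U_adm rhoP sec_holo) F_transl (x := y) (y := z).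
  have Fx_neq0 : F x != 0.
    apply/eqP => Fx0; apply: x_neq0.
    by rewrite (section_functionP s_gt0 sigmaP U_adm rhoP sec_holo dx) -/(F x) Fx0.
  apply: (mulIf Fx_neq0); rewrite mul1r.
  (* Constancy of [F] at [x] and at its image under [(u, 0)] gives [rho u * F x = F x]. *)
  rewrite -(F_equiv u 0 x Uu (ring_of_integers_int K 0) dx).
  by apply: F_const => //; apply: (OT_domain_act sigmaP U_adm).
(* For trivial [rho] the orbit of [(x, 1)] is the orbit of [x] times [{1}]: this is the constant
   section 1. *)
- exists (fun p => p `*` [set 1]).
  have secE x : OT_orbit sigma U x `*` [set 1] = line_orbit sigma U rho (x, 1).
    apply/seteqP; split=> [[y c] [[g Hg /= <-] /= ->]|_ [g Hg <-]].
      by exists g => //; rewrite /line_act /= rho_triv ?mulr1 //; case: Hg.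
    by split; [exists g|rewrite /= rho_triv ?mulr1 //; case: Hg].
  split; first split.
  + move=> _ [x dx <-]; rewrite secE; exists (x, 1) => //.
  + move=> p _; rewrite /bundle_proj; apply/seteqP; split=> [_ [[y c] [/= Hy _] <-] //|y Hy].
    by exists (y, 1).
  + move=> x dx; exists (fun=> 1); first by near=> y; exact: differentiable_cst.
    by near=> y; rewrite secE.
  + have dI : @OT_domain R s t (const_mx 'i) by move=> i; rewrite mxE /= ltr01.
    exists (const_mx 'i) => //; rewrite secE => /(line_orbit_inj s_gt0 sigmaP U_adm rhoP dI)/eqP.
    by rewrite oner_eq0.
Unshelve. all: by end_near. Qed.
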